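(* Let $x: M \rightarrow \mathbb{E}^{m}$ be an isometric immersion with parallel normalized mean curvature vector of a connected Riemannian surface $M$. Then the Laplace transformation $\mathcal{L} : M \rightarrow L(M)$ of $x$ is homothetic if and only if $M$ is immersed as a minimal surface in a hypersphere of $\mathbb{E}^m$ via $x$.
   Context: Manifolds and immersions are smooth and connected. $\Delta=-\operatorname{trace}\nabla^2$ is the Laplace operator of $M$. The Laplace map is $L:M\to\mathbb{E}^m$, $L(p)=(\Delta x)(p)$, equal to $-2H(p)$ where $H=\frac12\operatorname{trace}h$ is the mean curvature vector; the Laplace transformation $\mathcal L:M\to L(M)$ is $L$ regarded as a map onto its image. $\mathcal L$ is homothetic if there is a constant $c>0$ with $\langle dL(X),dL(Y)\rangle=c^2\langle X,Y\rangle$ for all tangent vectors $X,Y$ at a common point. A submanifold has parallel normalized mean curvature vector if $H$ is nowhere zero and the unit vector field in the direction of $H$ is parallel with respect to the normal connection. The hypersphere may have any center and radius. *)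

(* Defs.v *)
From HB Require Import structures.
From mathcomp Require Import all_boot all_order all_algebra.
From mathcomp Require Import all_classical all_reals all_analysis.

Set Implicit Arguments.
Unset Strict Implicit.
Unset Printing Implicit Defensive.

Import Order.TTheory GRing.Theory Num.Theory.
Import numFieldNormedType.Exports.

Local Open Scope classical_set_scope.
Local Open Scope ring_scope.

(* The library norm on row vectors is the sup norm: it is used here only for
   its topology.  The geometry of Euclidean space comes from [dot]. *)
Definition dot (R : realType) (m : nat) (u v : 'rV[R]_m) : R :=
  \sum_(i < m) u 0 i * v 0 i.

Definition enorm (R : realType) (m : nat) (u : 'rV[R]_m) : R :=
  Num.sqrt (dot u u).

Definition ebase (R : realType) (n : nat) (j : 'I_n) : 'rV[R]_n := delta_mx 0 j.

Definition pderiv (R : realType) (n : nat) (W : normedModType R) (j : 'I_n)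
    (f : 'rV[R]_n -> W) : 'rV[R]_n -> W :=
  fun q => 'D_(ebase R j) f q.

Fixpoint Ck (R : realType) (n : nat) (W : normedModType R) (k : nat)
    (U : set 'rV[R]_n) (f : 'rV[R]_n -> W) : Prop :=
  (forall q, U q -> {for q, continuous f}) /\
  (if k is k'.+1 then
     forall j : 'I_n, (forall q, U q -> derivable f q (ebase R j)) /\
                      Ck k' U (pderiv j f)
   else True).

Definition smooth_on (R : realType) (n : nat) (W : normedModType R)
    (U : set 'rV[R]_n) (f : 'rV[R]_n -> W) : Prop :=
  forall k, Ck k U f.

(* [cmap] is only meaningful on [cdom], and [cinv] on the image of [cdom]. *)
Record chart (R : realType) (n : nat) (M : topologicalType) := Chart {
  cdom : set M;
  cmap : M -> 'rV[R]_n;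
  cinv : 'rV[R]_n -> M;
  cdom_open : open cdom;
  cimg_open : open (cmap @` cdom);
  cmapK : forall p, cdom p -> cinv (cmap p) = p;
  cmap_cont : forall p, cdom p -> {for p, continuous cmap};
  cinv_cont : forall q, (cmap @` cdom) q -> {for q, continuous cinv} }.

Definition cimg (R : realType) (n : nat) (M : topologicalType)
    (c : chart R n M) : set 'rV[R]_n := cmap c @` cdom c.

Record smooth_manifold (R : realType) (n : nat) := SmoothManifold {
  carrier :> topologicalType;
  carrier_hausdorff : hausdorff_space carrier;
  carrier_second_countable : @second_countable carrier;
  atlas : set (chart R n carrier);
  atlas_cover : forall p : carrier, exists2 c, atlas c & cdom c p;
  atlas_compat : forall c d, atlas c -> atlas d ->
    smooth_on (cmap c @` (cdom c `&` cdom d)) (cmap d \o cinv c) }.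

Arguments atlas {R n} s _.
Arguments atlas_cover {R n} s p.

(* A chart of the atlas around p.  The pointwise objects evaluated in this chart
   below (Laplacian, mean curvature vector) do not depend on the choice. *)
Definition chart_at (R : realType) (n : nat) (M : smooth_manifold R n) (p : M) :
    chart R n M :=
  s2val (cid2 (atlas_cover M p)).

(* A tangent vector at p is represented, in each chart c around p, by its
   components u : 'rV_n on the coordinate frame; [dmap f c p u] is then df(u). *)
Definition dmap (R : realType) (n : nat) (M : smooth_manifold R n)
    (W : normedModType R) (f : M -> W) (c : chart R n M) (p : M) (u : 'rV[R]_n) :
    W :=
  'D_u (f \o cinv c) (cmap c p).

Definition smooth_map (R : realType) (n : nat) (M : smooth_manifold R n)
    (W : normedModType R) (f : M -> W) : Prop :=
  forall c, atlas M c -> smooth_on (cimg c) (f \o cinv c).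

(* [gmat c q] is the matrix (g_ab) of the metric in the chart c at the point of
   coordinates q; [gmat_compat] says that these matrices define one tensor. *)
Record riemannian_metric (R : realType) (n : nat) (M : smooth_manifold R n) :=
  RiemannianMetric {
  gmat : chart R n M -> 'rV[R]_n -> 'M[R]_n;
  gmat_smooth : forall c a b, atlas M c ->
    smooth_on (cimg c) (fun q => gmat c q a b);
  gmat_sym : forall c q, atlas M c -> cimg c q -> (gmat c q)^T = gmat c q;
  gmat_pos : forall c q (u : 'rV[R]_n), atlas M c -> cimg c q -> u != 0 ->
    0 < (u *m gmat c q *m u^T) 0 0;
  gmat_compat : forall c d p (u v : 'rV[R]_n),
    atlas M c -> atlas M d -> cdom c p -> cdom d p ->
    (u *m gmat c (cmap c p) *m v^T) 0 0 =
    (dmap (cmap d) c p u *m gmat d (cmap d p) *m (dmap (cmap d) c p v)^T) 0 0 }.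

Definition metric_at (R : realType) (n : nat) (M : smooth_manifold R n)
    (g : riemannian_metric M) (c : chart R n M) (p : M) (u v : 'rV[R]_n) : R :=
  (u *m gmat g c (cmap c p) *m v^T) 0 0.

Definition ginv (R : realType) (n : nat) (M : smooth_manifold R n)
    (g : riemannian_metric M) (c : chart R n M) (q : 'rV[R]_n) : 'M[R]_n :=
  invmx (gmat g c q).

(* Gamma^l_jk of the Levi-Civita connection *)
Definition christoffel (R : realType) (n : nat) (M : smooth_manifold R n)
    (g : riemannian_metric M) (c : chart R n M) (l j k : 'I_n) (q : 'rV[R]_n) :
    R :=
  2^-1 * \sum_(s < n) ginv g c q l s *
    (pderiv j (fun q' => gmat g c q' k s) q +
     pderiv k (fun q' => gmat g c q' j s) q -
     pderiv s (fun q' => gmat g c q' j k) q).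

Definition hessian (R : realType) (n : nat) (M : smooth_manifold R n)
    (g : riemannian_metric M) (c : chart R n M) (f : M -> R) (p : M) : 'M[R]_n :=
  \matrix_(j < n, k < n)
    (pderiv j (pderiv k (f \o cinv c)) (cmap c p) -
     \sum_(l < n) christoffel g c l j k (cmap c p) *
                  pderiv l (f \o cinv c) (cmap c p)).

Definition laplacian (R : realType) (n : nat) (M : smooth_manifold R n)
    (g : riemannian_metric M) (f : M -> R) (p : M) : R :=
  let c := chart_at p in - \tr (ginv g c (cmap c p) *m hessian g c f p).

Definition immersion (R : realType) (n m : nat) (M : smooth_manifold R n)
    (x : M -> 'rV[R]_m) : Prop :=
  smooth_map x /\
  forall c p (u : 'rV[R]_n), atlas M c -> cdom c p -> dmap x c p u = 0 -> u = 0.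

Definition isometric_immersion (R : realType) (n m : nat)
    (M : smooth_manifold R n) (g : riemannian_metric M) (x : M -> 'rV[R]_m) :
    Prop :=
  immersion x /\
  forall c p (u v : 'rV[R]_n), atlas M c -> cdom c p ->
    dot (dmap x c p u) (dmap x c p v) = metric_at g c p u v.

Definition laplace_map (R : realType) (n m : nat) (M : smooth_manifold R n)
    (g : riemannian_metric M) (x : M -> 'rV[R]_m) : M -> 'rV[R]_m :=
  fun p => \row_(i < m) laplacian g (fun q => x q 0 i) p.

(* v - sum_ab g^ab <v, d_b x> d_a x : for an isometric immersion, the orthogonal
   projection of v on the normal space at p. *)
Definition normal_part (R : realType) (n m : nat) (M : smooth_manifold R n)
    (g : riemannian_metric M) (x : M -> 'rV[R]_m) (c : chart R n M) (p : M)
    (v : 'rV[R]_m) : 'rV[R]_m :=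
  v - \sum_(a < n) \sum_(b < n)
        (ginv g c (cmap c p) a b * dot v (dmap x c p (ebase R b))) *:
          dmap x c p (ebase R a).

(* The derivative in E^m of the tangent field d_k x along d_j x *)
Definition ambient_deriv (R : realType) (n m : nat) (M : smooth_manifold R n)
    (x : M -> 'rV[R]_m) (c : chart R n M) (p : M) (j k : 'I_n) : 'rV[R]_m :=
  pderiv j (pderiv k (x \o cinv c)) (cmap c p).

Definition second_fundamental_form (R : realType) (n m : nat)
    (M : smooth_manifold R n) (g : riemannian_metric M) (x : M -> 'rV[R]_m)
    (c : chart R n M) (p : M) (j k : 'I_n) : 'rV[R]_m :=
  normal_part g x c p (ambient_deriv x c p j k).

Definition trace_form (R : realType) (n m : nat) (M : smooth_manifold R n)
    (g : riemannian_metric M) (c : chart R n M) (p : M)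
    (h : 'I_n -> 'I_n -> 'rV[R]_m) : 'rV[R]_m :=
  \sum_(j < n) \sum_(k < n) ginv g c (cmap c p) j k *: h j k.

Definition mean_curvature (R : realType) (n m : nat) (M : smooth_manifold R n)
    (g : riemannian_metric M) (x : M -> 'rV[R]_m) (p : M) : 'rV[R]_m :=
  let c := chart_at p in
  n%:R^-1 *: trace_form g c p (second_fundamental_form g x c p).

Definition unit_mean_curvature (R : realType) (n m : nat)
    (M : smooth_manifold R n) (g : riemannian_metric M) (x : M -> 'rV[R]_m)
    (p : M) : 'rV[R]_m :=
  (enorm (mean_curvature g x p))^-1 *: mean_curvature g x p.

Definition normal_connection (R : realType) (n m : nat)
    (M : smooth_manifold R n) (g : riemannian_metric M) (x : M -> 'rV[R]_m)
    (c : chart R n M) (p : M) (u : 'rV[R]_n) (xi : M -> 'rV[R]_m) : 'rV[R]_m :=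
  normal_part g x c p (dmap xi c p u).

Definition parallel_normalized_mean_curvature (R : realType) (n m : nat)
    (M : smooth_manifold R n) (g : riemannian_metric M) (x : M -> 'rV[R]_m) :
    Prop :=
  (forall p : M, mean_curvature g x p != 0) /\
  (forall c p (u : 'rV[R]_n), atlas M c -> cdom c p ->
     normal_connection g x c p u (unit_mean_curvature g x) = 0).

Definition homothetic (R : realType) (n m : nat) (M : smooth_manifold R n)
    (g : riemannian_metric M) (L : M -> 'rV[R]_m) : Prop :=
  exists2 k : R, 0 < k &
    forall c p (u v : 'rV[R]_n), atlas M c -> cdom c p ->
      dot (dmap L c p u) (dmap L c p v) = k ^+ 2 * metric_at g c p u v.

(* Orthogonal projection of v on the tangent space at y of the hypersphere with
   center a and radius r *)
Definition sphere_tangent_part (R : realType) (m : nat) (a : 'rV[R]_m) (r : R)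
    (y v : 'rV[R]_m) : 'rV[R]_m :=
  v - (dot v (y - a) / r ^+ 2) *: (y - a).

(* h^S(X, Y) = normal part to M of nabla^S_X Y, where the Levi-Civita connection
   nabla^S of the sphere is the tangential part of the ambient derivative. *)
Definition second_fundamental_form_in_sphere (R : realType) (n m : nat)
    (M : smooth_manifold R n) (g : riemannian_metric M) (x : M -> 'rV[R]_m)
    (a : 'rV[R]_m) (r : R) (c : chart R n M) (p : M) (j k : 'I_n) : 'rV[R]_m :=
  normal_part g x c p (sphere_tangent_part a r (x p) (ambient_deriv x c p j k)).

Definition mean_curvature_in_sphere (R : realType) (n m : nat)
    (M : smooth_manifold R n) (g : riemannian_metric M) (x : M -> 'rV[R]_m)
    (a : 'rV[R]_m) (r : R) (p : M) : 'rV[R]_m :=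
  let c := chart_at p in
  n%:R^-1 *: trace_form g c p (second_fundamental_form_in_sphere g x a r c p).

Definition minimal_in_hypersphere (R : realType) (n m : nat)
    (M : smooth_manifold R n) (g : riemannian_metric M) (x : M -> 'rV[R]_m) :
    Prop :=
  exists (a : 'rV[R]_m) (r : R),
    [/\ 0 < r,
        forall p : M, enorm (x p - a) = r
      & forall p : M, mean_curvature_in_sphere g x a r p = 0].

(* Main.v *)
Require Import Defs.
From HB Require Import structures.
From mathcomp Require Import all_boot all_order all_algebra.
From mathcomp Require Import all_classical all_reals all_analysis.
From mathcomp Require Import ring lra.

(* In a chart write y for the immersion, H for the mean curvature vector and
   u = |H|^2; the Laplace map is -2H.  If it is homothetic of ratio c and H/|H| is
   parallel, the Cayley-Hamilton theorem for the shape operator A_H gives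
   dH = -(c/2) dy + du F for an explicit vector field F.  Differentiating once more,
   dF is a multiple F1 du of du, dF1 = F2 du and dF2 = F3 du wherever du <> 0, so F,
   F1, F2 are functions of u alone.  They are orthogonal to the velocity and the
   acceleration of the level curves of u.  The trace of the second fundamental form
   expresses this acceleration through F, F1 and H modulo tangent vectors, which
   determines F1.F1 and the other inner products as rational functions of u, and the
   orthogonality to F2 then reads c + 4u = 0.  Hence du = 0, the surface is umbilic
   in the direction of H with dH = -u dy, and y + H/u is the centre of the
   hypersphere.  Conversely, a surface that is minimal in a hypersphere of centre a
   and radius r has H = -(x - a)/r^2, so its Laplace map is a homothety of x. *)

Set Implicit Arguments.
Unset Strict Implicit.
Unset Printing Implicit Defensive.

Import Order.TTheory GRing.Theory Num.Theory.
Import numFieldNormedType.Exports.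

Local Open Scope classical_set_scope.
Local Open Scope ring_scope.

(** * Partial derivatives and differentiability *)

(** Pointwise algebra cannot finish the proof: it only gives A_H the eigenvalues c/2 and 2u - c/2
    and ties the length of grad u to u by |grad u|^2 = 8 u^2 (c - 2u), which leaves u free to vary.
    Higher derivatives are needed. They stay tractable because H + (c/2) y has differential du F:
    symmetry of second derivatives makes dF proportional to du, and the same argument applies to F1
    and F2. The relation coming from the trace, used with F1, gives F1.F1; differentiating the known
    products gives those of F2 with H, F and F1; the same relation with F2 is then one equation too
    many. The codimension is arbitrary, so no normal frame is chosen and only inner products of H,
    F, F1, F2 occur. Curves and inverse functions are avoided as well: being a function of u alone
    is replaced by proportionality of differentials in a chart, on the open set where du does not
    vanish. Connectedness serves only to make the locally constant centre and radius global. *)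

Lemma mx_norm_coord (R : realType) m n (A : 'M[R]_(m, n)) i j : `|A i j| <= `|A|.
Proof. by rewrite [leRHS]/Num.Def.normr /= mx_normrE; exact: (le_bigmax _ _ (i, j)). Qed.

Lemma mx_norm_leP (R : realType) m n (A : 'M[R]_(m, n)) (e : R) :
  0 <= e -> (forall i j, `|A i j| <= e) -> `|A| <= e.
Proof.
by move=> e0 Ae; rewrite [leLHS]/Num.Def.normr /= mx_normrE bigmax_le // => -[].
Qed.

Lemma derivableZdir (R : realType) (V : normedModType R) (f : V -> R) p (e : V)
    (a : R) :
  derivable f p e -> is_derive p (a *: e) f (a * 'D_e f p).
Proof.
move=> dfe; have [->|a0] := eqVneq a 0.
  by rewrite scale0r mul0r; exact: is_derive0.
pose g (h : R) := f (h *: e + p).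
have dg : is_derive (0 : R) 1 g ('D_e f p).
  apply: DeriveDef; first by apply: (proj1 (@derivable1P _ _ _ f p e) dfe).
  by rewrite /derive /g /=; apply: (congr1 (fun k : R -> R => lim (k @ 0^')));
     apply/funext => h /=; rewrite !scaler1 addr0 scale0r add0r.
have da : is_derive (0 : R) 1 ( *%R a) a.
  by have := is_deriveZ a (is_derive_id (0 : R) 1); rewrite [_%:A]mulr1.
have := @is_derive1_comp _ g ( *%R a) 0 ('D_e f p) a.
rewrite mulr0 => /(_ dg da) [] dga vga; apply: DeriveDef.
  apply: (proj2 (derivable1P f p (a *: e))); move: dga.
  have -> // : g \o *%R a = (fun h : R => f (h *: (a *: e) + p)).
  by apply/funext => h /=; rewrite /g scalerA mulrC.
rewrite mulrC -vga /derive; apply: (congr1 (fun k : R -> R => lim (k @ 0^'))); apply/funext => h /=.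
by rewrite /g !scaler1 addr0 mulr0 scale0r add0r !scalerA mulrC.
Qed.

Lemma MVT_line (R : realType) (V : normedModType R) (f : V -> R) (p v : V) :
  (forall t : R, 0 <= t <= 1 -> derivable f (p + t *: v) v) ->
  exists2 t : R, 0 <= t <= 1 & f (p + v) - f p = 'D_v f (p + t *: v).
Proof.
move=> df; pose g (t : R) := f (p + t *: v).
have dg (t : R) : 0 <= t <= 1 -> is_derive t 1 g ('D_v f (p + t *: v)).
  move=> /df dft; have := proj1 (derivable1P f _ v) dft => dft'; apply: DeriveDef.
    apply: (proj2 (derivable1P g t 1)); move: dft'.
    have -> // : (fun h : R => f (h *: v + (p + t *: v))) = (fun h : R => g (h *: 1 + t)).
    by apply/funext => h; rewrite /g [_%:A]mulr1 scalerDl addrCA.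
  rewrite /derive /g; apply: (congr1 (fun k : R -> R => lim (k @ 0^'))); apply/funext => h /=.
  by rewrite [_%:A]mulr1 scalerDl addrCA.
have [|||t t01 gt] := @MVT_segment R g (fun t => 'D_v f (p + t *: v)) 0 1.
- exact: ler01.
- move=> t; rewrite in_itv /= => /andP[t0 t1]; apply: dg.
  by rewrite !ltW.
- apply: derivable_within_continuous => t; rewrite in_itv /= => t01.
  by have [] := dg _ t01.
exists t; first by move: t01; rewrite in_itv.
by move: gt; rewrite /g scale1r scale0r addr0 subr0 mulr1.
Qed.

(** The candidate differential, as a function of its own so that it can carry the linear structure
    that [diff_unique] expects. *)
Definition gradient_form (R : realType) n (a : 'I_n -> R) (h : 'rV[R]_n) : R :=
  \sum_j h 0 j * a j.

Lemma gradient_form_is_linear (R : realType) n (a : 'I_n -> R) :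
  linear (gradient_form a).
Proof.
move=> k u v; rewrite /gradient_form scaler_sumr -big_split /=.
by apply: eq_bigr => j _; rewrite !mxE mulrDl -mulrA.
Qed.

HB.instance Definition _ (R : realType) n (a : 'I_n -> R) :=
  GRing.isLinear.Build R 'rV[R]_n R *:%R (gradient_form a)
    (gradient_form_is_linear a).

Lemma continuous_at_sum (R : realType) (T : topologicalType) (W : normedModType R)
    n (F : 'I_n -> T -> W) (q : T) :
  (forall i, {for q, continuous (F i)}) ->
  {for q, continuous (fun x => \sum_i F i x)}.
Proof.
elim: n F => [|n IH] F cF.
  have -> : (fun x => \sum_i F i x) = (fun=> 0) by apply/funext => x; rewrite big_ord0.
  exact: cvg_cst.
have -> : (fun x => \sum_i F i x) =
    (fun x => \sum_(i < n) F (widen_ord (leqnSn n) i) x) + F ord_max.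
  by apply/funext => x; rewrite big_ord_recr.
apply: continuousD; last exact: cF.
by apply: IH => i; exact: cF.
Qed.

Lemma gradient_form_continuous (R : realType) n (a : 'I_n -> R) :
  continuous (gradient_form a).
Proof.
move=> h; apply: continuous_at_sum => j.
have c1 : {for h, continuous (fun M : 'rV[R]_n => M 0 j)}.
  exact: (@coord_continuous R 1 n 0 j h).
exact: (continuousM c1 (@cst_continuous _ _ (a j) h)).
Qed.

Lemma row_telescope (R : realType) n (h : 'rV[R]_n) k (kn : (k < n)%N) :
  \row_i (if (i < k.+1)%N then h 0 i else 0) =
  \row_i (if (i < k)%N then h 0 i else 0) + h 0 (Ordinal kn) *: ebase R (Ordinal kn).
Proof.
apply/rowP => i; rewrite !mxE eqxx /= ltnS leq_eqVlt -[_ == Ordinal kn]val_eqE /=.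
case: eqP => [ik|ik] /=; last by rewrite mulr0 addr0.
by rewrite ik ltnn add0r mulr1; congr (h 0 _); apply: val_inj.
Qed.

(** Go from q to q + h one coordinate at a time. The mean value theorem turns each step into a
    partial derivative at a point near q, and continuity at q compares it with the one at q. *)
Lemma differentiable_of_pderiv (R : realType) n (U : set 'rV[R]_n)
    (f : 'rV[R]_n -> R) q :
  open U -> U q -> (forall j p, U p -> derivable f p (ebase R j)) ->
  (forall j, {for q, continuous (pderiv j f)}) ->
  differentiable f q /\ forall v, 'D_v f q = \sum_j v 0 j * pderiv j f q.
Proof.
move=> oU Uq df cf.
pose a j := pderiv j f q.
have DU := @diff_unique R 'rV[R]_n R f (gradient_form a) q (@gradient_form_continuous R n a).
(* The premise of [DU] is the little-o estimate. The two conclusions are drawn from it first; the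
   rest of the proof establishes it. *)
lazymatch type of DU with ?P -> _ => suff H : P end.
  have E := DU H.
  have D : differentiable f q.
    apply/diff_locallyP; rewrite E; split; last exact: H.
    exact: (@gradient_form_continuous R n a).
  by split => // v; rewrite deriveE // E.
apply/eqaddoP => e e0.
(* With [n.+1] instead of [n], the share of e given to each coordinate stays positive when n = 0. *)
have n0 : 0 < n.+1%:R :> R by rewrite ltr0n.
have eb : 0 < e / n.+1%:R by rewrite divr_gt0.
have nb j : \forall p \near q, `|a j - pderiv j f p| <= e / n.+1%:R.
  exact: (cvgrPdist_le _ _).1 (cf j) _ eb.
have /nbhs_ballP [r /= r0 rb] :
    \forall p \near q, U p /\ forall j, `|a j - pderiv j f p| <= e / n.+1%:R.
  apply: (@filterI _ _ (nbhs_filter q)); first exact: open_nbhs_nbhs.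
  exact: (@filter_forall _ _ _ _ (nbhs_filter q) nb).
near=> h.
have hr : `|h| < r.
  near: h; apply/nbhs_ballP; exists r => //= z.
  by rewrite -ball_normE /ball_ /= sub0r normrN.
(* The corners of the path: h truncated to its first k coordinates. *)
pose w k := q + \row_i (if (i < k)%N then h 0 i else 0).
have wb k (kn : (k < n)%N) (t : R) : 0 <= t <= 1 ->
    ball q r (w k + t *: (h 0 (Ordinal kn) *: ebase R (Ordinal kn))).
  move=> /andP[t0 t1]; rewrite -ball_normE /ball_ /= /w -addrA opprD addNKr.
  rewrite normrN; apply: le_lt_trans hr; apply: mx_norm_leP => // i j.
  rewrite !mxE -[j == Ordinal kn]val_eqE /= ord1 eqxx /=.
  have hj := mx_norm_coord h 0 j.
  case: (ltngtP j k) => [jk|jk|jk]; rewrite ?mulr0 ?addr0 ?normr0 //.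
  rewrite add0r mulr1 normrM ger0_norm //.
  rewrite (_ : Ordinal kn = j); last by apply: val_inj.
  by rewrite (le_trans _ hj) // ler_piMl.
have step k (kn : (k < n)%N) :
    `|f (w k.+1) - f (w k) - h 0 (Ordinal kn) * a (Ordinal kn)| <= `|h| * (e / n.+1%:R).
  have wS : w k.+1 = w k + h 0 (Ordinal kn) *: ebase R (Ordinal kn).
    by rewrite /w row_telescope addrA.
  rewrite wS; have [|t t01 ->] := @MVT_line _ _ f (w k) (h 0 (Ordinal kn) *: ebase R (Ordinal kn)).
    move=> t /(wb k kn) /rb [Uw _].
    by have [Hd _] := derivableZdir (h 0 (Ordinal kn)) (df (Ordinal kn) _ Uw).
  have [Uw aw] := rb _ (wb k kn _ t01).
  have [_ ->] := derivableZdir (h 0 (Ordinal kn)) (df (Ordinal kn) _ Uw).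
  rewrite -mulrBr normrM ler_pM // ?mx_norm_coord // distrC; exact: aw.
have -> : (f \o shift q - (cst (f q) + gradient_form a)) h =
    \sum_(k < n) (f (w k.+1) - f (w k) - h 0 k * a k).
  rewrite big_split /= sumrN -(big_mkord xpredT (fun k => f (w k.+1) - f (w k))).
  rewrite telescope_sumr //.
  rewrite -[LHS]/(f (h + q) - (f q + \sum_j h 0 j * a j)) opprD addrA.
  congr (f _ - f _ - _).
    by rewrite addrC; congr (_ + _); apply/rowP => i; rewrite mxE ltn_ord.
  by rewrite /w (_ : \row_i _ = 0) ?addr0 //; apply/rowP => i; rewrite !mxE.
apply: le_trans (ler_norm_sum _ _ _) _.
apply: (@le_trans _ _ (\sum_(k < n) `|h| * (e / n.+1%:R))).
  by apply: ler_sum => -[k kn] _; exact: step.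
rewrite sumr_const card_ord -[_ *+ n]mulr_natl mulrCA.
have -> : e * `|id h| = `|h| * e by rewrite mulrC.
apply: ler_wpM2l => //; rewrite mulrCA ler_piMr ?ltW //.
by rewrite ltr_pdivrMr // mul1r ltr_nat.
Unshelve. all: by end_near. Qed.

(** * Smooth functions *)

Lemma is_derive_line (R : realType) (V W : normedModType R) (f : V -> W) q v a :
  is_derive q v f a <-> is_derive (0 : R) 1 (fun h : R => f (h *: v + q)) a.
Proof.
have E : 'D_1 (fun h : R => f (h *: v + q)) 0 = 'D_v f q.
  rewrite /derive; apply: (congr1 (fun k : R -> W => lim (k @ 0^'))).
  by apply/funext => h /=; rewrite [_%:A]mulr1 addr0 scale0r add0r.
split=> -[d e]; apply: DeriveDef.
- exact: (proj1 (derivable1P f q v) d).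
- by rewrite E.
- exact: (proj2 (derivable1P f q v) d).
- by rewrite -E.
Qed.

Lemma is_derive_chain1 (R : realType) (V : normedModType R) (g : R -> R)
    (f : V -> R) q v a b :
  is_derive (f q) 1 g b -> is_derive q v f a ->
  is_derive q v (fun p => g (f p)) (b * a).
Proof.
move=> dg /is_derive_line df; apply/is_derive_line.
by apply: (@is_derive1_comp _ g (fun h : R => f (h *: v + q))) => //;
   rewrite scale0r add0r.
Qed.

Lemma is_derive_chain (R : realType) (V W X : normedModType R) (f : W -> X)
    (g : V -> W) q v w :
  differentiable f (g q) -> is_derive q v g w ->
  is_derive q v (fun p => f (g p)) ('D_w f (g q)).
Proof.
move=> df /is_derive_line [dg <-]; apply/is_derive_line.
set G := fun h : R => g (h *: v + q).
have G0 : G 0 = g q by rewrite /G scale0r add0r.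
have dG : differentiable G (0 : R) by apply/derivable1_diffP.
have df' : differentiable f (G 0) by rewrite G0.
have dfG : differentiable (f \o G) (0 : R) by exact: differentiable_comp.
apply: DeriveDef; first exact: diff_derivable.
by rewrite (deriveE _ dfG) diff_comp //= (deriveE _ df) (deriveE _ dG) G0.
Qed.

Lemma is_derive_coord (R : realType) (V : normedModType R) m (F : V -> 'rV[R]_m)
    q v dF i :
  is_derive q v F dF -> is_derive q v (fun p => F p 0 i) (dF 0 i).
Proof.
move=> [dFq <-]; apply: DeriveDef; first exact: (proj1 (derivable_mxP F q v) dFq).
by rewrite derive_mx // mxE.
Qed.

Lemma is_derive_row (R : realType) (V : normedModType R) m (F : V -> 'rV[R]_m)
    q v (dF : 'rV[R]_m) :
  (forall i, is_derive q v (fun p => F p 0 i) (dF 0 i)) -> is_derive q v F dF.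
Proof.
move=> H; have dFq : derivable F q v.
  by apply/derivable_mxP => i j; rewrite ord1; have [] := H j.
apply: DeriveDef => //; rewrite derive_mx //; apply/rowP => i; rewrite mxE.
by have [_ ->] := H i.
Qed.

Lemma is_derive_mul (R : realType) (V : normedModType R) (f g : V -> R) q v df dg :
  is_derive q v f df -> is_derive q v g dg ->
  is_derive q v (fun p => f p * g p) (df * g q + f q * dg).
Proof.
move=> hf hg; have [H1 H2] := is_deriveM hf hg; apply: DeriveDef; first exact: H1.
by rewrite [LHS]H2 addrC; congr (_ + _); rewrite mulrC.
Qed.

Lemma is_derive_scale (R : realType) (V : normedModType R) m (a : V -> R)
    (F : V -> 'rV[R]_m) q v da dF :
  is_derive q v a da -> is_derive q v F dF ->
  is_derive q v (fun p => a p *: F p) (da *: F q + a q *: dF).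
Proof.
move=> ha hF; apply: is_derive_row => i; rewrite !mxE.
have -> : (fun p => (a p *: F p) 0 i) = (fun p => a p * F p 0 i).
  by apply/funext => p; rewrite mxE.
by apply: is_derive_mul => //; exact: is_derive_coord.
Qed.

Lemma is_derive_bigsum (R : realType) (V W : normedModType R) n (h : 'I_n -> V -> W)
    q v (dh : 'I_n -> W) :
  (forall i, is_derive q v (h i) (dh i)) ->
  is_derive q v (fun p => \sum_(i < n) h i p) (\sum_(i < n) dh i).
Proof.
move=> H; have [H1 H2] := @is_derive_sum _ _ _ n h q v dh H.
have E : (fun p => \sum_(i < n) h i p) = \sum_(i < n) h i.
  by apply/funext => p; rewrite fct_sumE.
by apply: DeriveDef; rewrite E.
Qed.

Lemma is_derive_dot (R : realType) (V : normedModType R) m (F G : V -> 'rV[R]_m)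
    q v dF dG :
  is_derive q v F dF -> is_derive q v G dG ->
  is_derive q v (fun p => dot (F p) (G p)) (dot dF (G q) + dot (F q) dG).
Proof.
move=> hF hG; rewrite /dot -big_split /=; apply: is_derive_bigsum => i.
by apply: is_derive_mul; exact: is_derive_coord.
Qed.

Lemma is_derive_eq_on (R : realType) (V W : normedModType R) (U : set V)
    (f g : V -> W) q v df :
  open U -> U q -> (forall p, U p -> f p = g p) ->
  is_derive q v f df -> is_derive q v g df.
Proof.
move=> oU Uq fg; apply: near_eq_is_derive.
by apply: (@filterS _ _ (nbhs_filter q) U) => //; exact: open_nbhs_nbhs.
Qed.

Lemma derive_unique (R : realType) (V W : normedModType R) (f : V -> W) q v a b :
  is_derive q v f a -> is_derive q v f b -> a = b.
Proof. by move=> [_ <-] [_ <-]. Qed.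

Lemma continuous_at_eq_on (T S : topologicalType) (U : set T) (f g : T -> S) q :
  open U -> U q -> (forall p, U p -> f p = g p) ->
  {for q, continuous f} -> {for q, continuous g}.
Proof.
move=> oU Uq fg cf A; rewrite -(fg _ Uq) => /cf fA.
have nU : nbhs q U by exact: open_nbhs_nbhs.
apply: (@filterS _ _ (nbhs_filter q) (U `&` (f @^-1` A))); last exact: filterI.
by move=> p [Up]; rewrite /= -(fg _ Up).
Qed.

Section smooth_functions.
Context {R : realType} {n : nat}.
Implicit Types (W : normedModType R) (U : set 'rV[R]_n).

Lemma Ck_cont W k U (f : 'rV[R]_n -> W) q : Ck k U f -> U q -> {for q, continuous f}.
Proof. by case: k => [|k] [H _] Uq; exact: H. Qed.

Lemma CkW W k U (f : 'rV[R]_n -> W) : Ck k.+1 U f -> Ck k U f.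
Proof.
elim: k f => [|k IH] f [H1 H2]; first by split.
by split=> // j; have [H3 H4] := H2 j; split=> //; exact: IH.
Qed.

Lemma Ck_eq W k U (f g : 'rV[R]_n -> W) :
  open U -> (forall q, U q -> f q = g q) -> Ck k U f -> Ck k U g.
Proof.
move=> oU; elim: k f g => [|k IH] f g fg [H1 H2]; split=> //.
1,2: by move=> q Uq; apply: (continuous_at_eq_on oU Uq fg); exact: H1.
move=> j; have [H3 H4] := H2 j.
have D q : U q -> is_derive q (ebase R j) g (pderiv j f q).
  by move=> Uq; apply: (is_derive_eq_on oU Uq fg); exact: derivableP (H3 _ Uq).
split=> [q /D[]//|]; apply: IH H4 => q /D [_ <-]; exact: erefl.
Qed.

(** The induction step shared by the closure lemmas below: derivatives need only be exhibited on U,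
    in a form to which the induction hypothesis applies. *)
Lemma CkS W k U (f : 'rV[R]_n -> W) (df : 'I_n -> 'rV[R]_n -> W) :
  open U -> (forall q, U q -> {for q, continuous f}) ->
  (forall j q, U q -> is_derive q (ebase R j) f (df j q)) ->
  (forall j, Ck k U (df j)) -> Ck k.+1 U f.
Proof.
move=> oU cf D Cd; split=> // j; split=> [q /(D j)[]//|].
by apply: Ck_eq (Cd j) => // q /(D j)[_ <-].
Qed.

Lemma Ck_derive W k U (f : 'rV[R]_n -> W) j q :
  Ck k.+1 U f -> U q -> is_derive q (ebase R j) f (pderiv j f q).
Proof. by move=> [_ /(_ j)[H _]] Uq; exact: derivableP (H _ Uq). Qed.

Lemma Ck_pderiv W k U (f : 'rV[R]_n -> W) j : Ck k.+1 U f -> Ck k U (pderiv j f).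
Proof. by move=> [_ /(_ j)[]]. Qed.

Lemma Ck_cst W k U (a : W) : open U -> Ck k U (fun=> a).
Proof.
move=> oU; elim: k a => [|k IH] a.
  by split=> // q _; exact: (@cst_continuous _ _ a q).
apply: (@CkS _ _ _ _ (fun _ _ => 0)) => //.
by move=> q _; exact: (@cst_continuous _ _ a q).
Qed.

Lemma CkD W k U (f g : 'rV[R]_n -> W) :
  open U -> Ck k U f -> Ck k U g -> Ck k U (fun q => f q + g q).
Proof.
move=> oU; elim: k f g => [|k IH] f g Cf Cg.
  by split=> // q Uq; exact: (continuousD (Ck_cont Cf Uq) (Ck_cont Cg Uq)).
apply: (@CkS _ _ _ _ (fun j q => pderiv j f q + pderiv j g q)) => //.
- by move=> q Uq; exact: (continuousD (Ck_cont Cf Uq) (Ck_cont Cg Uq)).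
- by move=> j q Uq; exact: (is_deriveD (Ck_derive j Cf Uq) (Ck_derive j Cg Uq)).
- by move=> j; apply: IH; exact: Ck_pderiv.
Qed.

Lemma Ck_mul k U (f g : 'rV[R]_n -> R) :
  open U -> Ck k U f -> Ck k U g -> Ck k U (fun q => f q * g q).
Proof.
move=> oU; elim: k f g => [|k IH] f g Cf Cg.
  by split=> // q Uq; exact: (continuousM (Ck_cont Cf Uq) (Ck_cont Cg Uq)).
apply: (@CkS _ _ _ _ (fun j q => pderiv j f q * g q + f q * pderiv j g q)) => //.
- by move=> q Uq; exact: (continuousM (Ck_cont Cf Uq) (Ck_cont Cg Uq)).
- by move=> j q Uq; exact: (is_derive_mul (Ck_derive j Cf Uq) (Ck_derive j Cg Uq)).
- by move=> j; apply: CkD => //; apply: IH; do ?[exact: Ck_pderiv | exact: CkW].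
Qed.

Lemma Ck_inv k U (f : 'rV[R]_n -> R) :
  open U -> (forall q, U q -> f q != 0) -> Ck k U f -> Ck k U (fun q => (f q)^-1).
Proof.
move=> oU f0; elim: k f f0 => [|k IH] f f0 Cf.
  by split=> // q Uq; exact: (continuousV (f0 _ Uq) (Ck_cont Cf Uq)).
(* The derivative is written with the inverse itself as a factor, so that the induction hypothesis
   covers it. *)
apply: (@CkS _ _ _ _ (fun j q => - 1 * ((f q)^-1 * (f q)^-1) * pderiv j f q)) => //.
- by move=> q Uq; exact: (continuousV (f0 _ Uq) (Ck_cont Cf Uq)).
- move=> j q Uq; have [H _] := Ck_derive j Cf Uq.
  apply: DeriveDef; first exact: derivableV (f0 _ Uq) H.
  by rewrite deriveV ?f0 // expr2 invfM mulN1r.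
- move=> j; have CI : Ck k U (fun q => (f q)^-1) by apply: IH => //; exact: CkW.
  by do !apply: Ck_mul => //; [exact: Ck_cst | exact: Ck_pderiv].
Qed.

Lemma Ck_sqrt k U (f : 'rV[R]_n -> R) :
  open U -> (forall q, U q -> 0 < f q) -> Ck k U f -> Ck k U (fun q => Num.sqrt (f q)).
Proof.
move=> oU f0.
have cs (h : 'rV[R]_n -> R) q : {for q, continuous h} ->
    {for q, continuous (fun q => Num.sqrt (h q))}.
  by move=> ch; exact: (continuous_comp ch (@sqrt_continuous R (h q))).
elim: k => [|k IH] Cf.
  by split=> // q Uq; exact: cs (Ck_cont Cf Uq).
have Ck' := IH (CkW Cf).
apply: (@CkS _ _ _ _ (fun j q => (2 * Num.sqrt (f q))^-1 * pderiv j f q)) => //.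
- by move=> q Uq; exact: cs (Ck_cont Cf Uq).
- move=> j q Uq; apply: is_derive_chain1 (Ck_derive j Cf Uq).
  exact: is_derive1_sqrt (f0 _ Uq).
- move=> j; apply: Ck_mul => //; last exact: Ck_pderiv.
  apply: Ck_inv => //; last by apply: Ck_mul => //; exact: Ck_cst.
  by move=> q Uq; rewrite mulf_neq0 // ?pnatr_eq0 // gt_eqF // sqrtr_gt0 f0.
Qed.

Lemma Ck_coord m k U (F : 'rV[R]_n -> 'rV[R]_m) i :
  open U -> Ck k U F -> Ck k U (fun q => F q 0 i).
Proof.
move=> oU.
have cc (h : 'rV[R]_n -> 'rV[R]_m) q : {for q, continuous h} ->
    {for q, continuous (fun q => h q 0 i)}.
  by move=> ch; exact: (continuous_comp ch (@coord_continuous R 1 m 0 i (h q))).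
elim: k F => [|k IH] F CF; first by split=> // q Uq; exact: cc (Ck_cont CF Uq).
apply: (@CkS _ _ _ _ (fun j q => pderiv j F q 0 i)) => //.
- by move=> q Uq; exact: cc (Ck_cont CF Uq).
- by move=> j q Uq; exact: is_derive_coord (Ck_derive j CF Uq).
- by move=> j; exact: IH (Ck_pderiv j CF).
Qed.

Lemma continuous_at_row m (F : 'rV[R]_n -> 'rV[R]_m) q :
  (forall i, {for q, continuous (fun q => F q 0 i)}) -> {for q, continuous F}.
Proof.
move=> cF A /nbhs_ballP [e /= e0 eA].
have H j : nbhs q [set p | ball (F q 0 j) e (F p 0 j)].
  by apply: (cF j); exact: nbhsx_ballx.
apply: (@filterS _ _ (nbhs_filter q)) (@filter_forall _ _ _ _ (nbhs_filter q) H).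
by move=> p /= Hp; apply: eA; split=> // i j; rewrite ord1.
Qed.

Lemma Ck_row m k U (F : 'rV[R]_n -> 'rV[R]_m) :
  open U -> (forall i, Ck k U (fun q => F q 0 i)) -> Ck k U F.
Proof.
move=> oU; elim: k F => [|k IH] F CF.
  by split=> // q Uq; apply: continuous_at_row => i; exact: Ck_cont (CF i) Uq.
apply: (@CkS _ _ _ _ (fun j q => \row_i pderiv j (fun q => F q 0 i) q)) => //.
- by move=> q Uq; apply: continuous_at_row => i; exact: Ck_cont (CF i) Uq.
- move=> j q Uq; apply: is_derive_row => i; rewrite mxE; exact: Ck_derive (CF i) Uq.
- move=> j; apply: IH => i; apply: Ck_eq (Ck_pderiv j (CF i)) => // q _.
  by rewrite mxE.
Qed.

Lemma smooth_eq W U (f g : 'rV[R]_n -> W) :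
  open U -> (forall q, U q -> f q = g q) -> smooth_on U f -> smooth_on U g.
Proof. by move=> oU fg Cf k; exact: Ck_eq (Cf k). Qed.

Lemma smooth_sub W U U' (f : 'rV[R]_n -> W) :
  U' `<=` U -> smooth_on U f -> smooth_on U' f.
Proof.
move=> UU Cf k; have {Cf} := Cf k; elim: k f => [|k IH] f [H1 H2]; split=> //.
- by move=> q /UU; exact: H1.
- by move=> q /UU; exact: H1.
- by move=> j; have [H3 H4] := H2 j; split=> [q /UU|]; [exact: H3 | exact: IH].
Qed.

Lemma smooth_cont W U (f : 'rV[R]_n -> W) q :
  smooth_on U f -> U q -> {for q, continuous f}.
Proof. by move=> /(_ 0%N) /Ck_cont; apply. Qed.

Lemma smooth_derive W U (f : 'rV[R]_n -> W) j q :
  smooth_on U f -> U q -> is_derive q (ebase R j) f (pderiv j f q).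
Proof. by move=> /(_ 1%N) Cf Uq; exact: Ck_derive Cf Uq. Qed.

Lemma smooth_pderiv W U (f : 'rV[R]_n -> W) j : smooth_on U f -> smooth_on U (pderiv j f).
Proof. by move=> Cf k; exact: Ck_pderiv (Cf k.+1). Qed.

Lemma smooth_cst W U (a : W) : open U -> smooth_on U (fun=> a).
Proof. by move=> oU k; exact: Ck_cst. Qed.

Lemma smoothD W U (f g : 'rV[R]_n -> W) :
  open U -> smooth_on U f -> smooth_on U g -> smooth_on U (fun q => f q + g q).
Proof. by move=> oU Cf Cg k; exact: CkD. Qed.

Lemma smoothM U (f g : 'rV[R]_n -> R) :
  open U -> smooth_on U f -> smooth_on U g -> smooth_on U (fun q => f q * g q).
Proof. by move=> oU Cf Cg k; exact: Ck_mul. Qed.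

Lemma smoothV U (f : 'rV[R]_n -> R) :
  open U -> (forall q, U q -> f q != 0) -> smooth_on U f ->
  smooth_on U (fun q => (f q)^-1).
Proof. by move=> oU f0 Cf k; exact: Ck_inv. Qed.

Lemma smooth_sqrt U (f : 'rV[R]_n -> R) :
  open U -> (forall q, U q -> 0 < f q) -> smooth_on U f ->
  smooth_on U (fun q => Num.sqrt (f q)).
Proof. by move=> oU f0 Cf k; exact: Ck_sqrt. Qed.

Lemma smooth_coord m U (F : 'rV[R]_n -> 'rV[R]_m) i :
  open U -> smooth_on U F -> smooth_on U (fun q => F q 0 i).
Proof. by move=> oU CF k; exact: Ck_coord. Qed.

Lemma smooth_row m U (F : 'rV[R]_n -> 'rV[R]_m) :
  open U -> (forall i, smooth_on U (fun q => F q 0 i)) -> smooth_on U F.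
Proof. by move=> oU CF k; apply: Ck_row => // i; exact: CF. Qed.

Lemma smooth_sum W p U (f : 'I_p -> 'rV[R]_n -> W) :
  open U -> (forall i, smooth_on U (f i)) -> smooth_on U (fun q => \sum_i f i q).
Proof.
move=> oU; elim: p f => [|p IH] f Cf.
  by apply: smooth_eq (smooth_cst 0 oU) => // q _; rewrite big_ord0.
apply: (@smooth_eq _ _ (fun q => \sum_(i < p) f (widen_ord (leqnSn p) i) q + f ord_max q)) => //.
  by move=> q _; rewrite big_ord_recr.
by apply: smoothD => //; apply: IH => i.
Qed.

Lemma smooth_dot m U (F G : 'rV[R]_n -> 'rV[R]_m) :
  open U -> smooth_on U F -> smooth_on U G -> smooth_on U (fun q => dot (F q) (G q)).
Proof.
move=> oU CF CG; apply: smooth_sum => // i.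
by apply: smoothM => //; exact: smooth_coord.
Qed.

Lemma smoothZ m U (a : 'rV[R]_n -> R) (F : 'rV[R]_n -> 'rV[R]_m) :
  open U -> smooth_on U a -> smooth_on U F -> smooth_on U (fun q => a q *: F q).
Proof.
move=> oU Ca CF; apply: smooth_row => // i.
apply: (@smooth_eq _ _ (fun q => a q * F q 0 i)) => //; first by move=> q _; rewrite mxE.
by apply: smoothM => //; exact: smooth_coord.
Qed.

End smooth_functions.

(** * Symmetry of second derivatives *)

Lemma smooth_differentiable (R : realType) n U (f : 'rV[R]_n -> R) q :
  open U -> smooth_on U f -> U q ->
  differentiable f q /\ forall v, 'D_v f q = \sum_j v 0 j * pderiv j f q.
Proof.
move=> oU Cf Uq; apply: (differentiable_of_pderiv oU Uq).
- by move=> j p Up; have [] := smooth_derive j Cf Up.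
- by move=> j; exact: smooth_cont (smooth_pderiv j Cf) Uq.
Qed.

Lemma smooth_derive_dir (R : realType) n m U (F : 'rV[R]_n -> 'rV[R]_m) q v :
  open U -> smooth_on U F -> U q ->
  is_derive q v F (\sum_j v 0 j *: pderiv j F q).
Proof.
move=> oU CF Uq; apply: is_derive_row => i.
have [d E] := smooth_differentiable oU (smooth_coord i oU CF) Uq.
apply: DeriveDef; first exact: diff_derivable.
rewrite E summxE; apply: eq_bigr => j _; rewrite mxE; congr (_ * _).
by have [_ H] := is_derive_coord i (smooth_derive j CF Uq); exact: H.
Qed.

Lemma smooth_chain (R : realType) n m p U (F : 'rV[R]_n -> 'rV[R]_m)
    (phi : 'rV[R]_p -> 'rV[R]_n) q v w :
  open U -> smooth_on U F -> U (phi q) -> is_derive q v phi w ->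
  is_derive q v (fun q => F (phi q)) (\sum_j w 0 j *: pderiv j F (phi q)).
Proof.
move=> oU CF Uq dphi; apply: is_derive_row => i.
have [d E] := smooth_differentiable oU (smooth_coord i oU CF) Uq.
apply: is_derive_eq (is_derive_chain d dphi) _.
rewrite E summxE; apply: eq_bigr => j _; rewrite mxE; congr (_ * _).
by have [_ H] := is_derive_coord i (smooth_derive j CF Uq); exact: H.
Qed.

Lemma open_rV_ball (R : realType) n (U : set 'rV[R]_n) q :
  open U -> U q -> exists2 r : R, 0 < r & ball q r `<=` U.
Proof. by rewrite openE => oU /oU /nbhs_ballP. Qed.

Lemma gradient_eq0_ball (R : realType) n U (f : 'rV[R]_n -> R) q (r : R) :
  open U -> smooth_on U f -> ball q r `<=` U ->
  (forall j p, U p -> pderiv j f p = 0) ->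
  forall p, ball q r p -> f p = f q.
Proof.
move=> oU Cf rU g0 p qp.
have r0 : 0 < r by have [] := qp.
have B (t : R) : 0 <= t <= 1 -> U (q + t *: (p - q)).
  move=> /andP[t0 t1]; apply: rU; rewrite -ball_normE /ball_ /=.
  move: qp; rewrite -ball_normE /ball_ /= distrC => qp.
  by rewrite opprD addNKr normrN normrZ ger0_norm //; apply: le_lt_trans qp; rewrite ler_piMl.
have [|t t01] := @MVT_line _ _ f q (p - q).
  move=> t /B Ut; have [d _] := smooth_differentiable oU Cf Ut.
  exact: diff_derivable.
have [_ ->] := smooth_differentiable oU Cf (B _ t01).
rewrite big1 => [|j _]; last by rewrite g0 ?mulr0 //; exact: B.
have -> : q + (p - q) = p by rewrite addrC subrK.
by move=> /eqP; rewrite subr_eq0 => /eqP.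
Qed.

Section Schwarz.
Context {R : realType} {n : nat}.
Variables (U : set 'rV[R]_n) (f : 'rV[R]_n -> R) (q : 'rV[R]_n).
Hypotheses (oU : open U) (Cf : smooth_on U f) (Uq : U q).

(* Apply the mean value theorem once in each direction. *)
Lemma second_difference i j (r : R) :
  0 < r -> (forall s t : R, 0 <= s <= r -> 0 <= t <= r ->
            U (q + s *: ebase R i + t *: ebase R j)) ->
  exists s t : R, [/\ 0 <= s <= r, 0 <= t <= r &
    f (q + r *: ebase R i + r *: ebase R j) - f (q + r *: ebase R i)
      - (f (q + r *: ebase R j) - f q) =
    r * (r * pderiv j (pderiv i f) (q + s *: ebase R i + t *: ebase R j))].
Proof.
move=> r0 HU; set ei := ebase R i; set ej := ebase R j.
have sc (t : R) : 0 <= t <= 1 -> 0 <= t * r <= r.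
  by move=> /andP[t0 t1]; have rw := ltW r0; rewrite mulr_ge0 //= ler_piMl.
have r00 : 0 <= (0 : R) <= r by rewrite lexx ltW.
have rr : 0 <= r <= r by rewrite lexx ltW.
pose g p := f (p + r *: ej) - f p.
have dg (t : R) : 0 <= t <= r -> is_derive (q + t *: ei) ei g
    (pderiv i f (q + t *: ei + r *: ej) - pderiv i f (q + t *: ei)).
  move=> t0r; have U1 := HU t r t0r rr; have := HU t 0 t0r r00.
  rewrite scale0r addr0 => U2.
  have sh : is_derive (q + t *: ei) ei (fun p => f (p + r *: ej))
      (pderiv i f (q + t *: ei + r *: ej)).
    have [d _] := smooth_differentiable oU Cf U1.
    apply: (@is_derive_chain _ _ _ _ f (fun p => p + r *: ej)) => //.
    have := is_deriveD (is_derive_id (q + t *: ei) ei)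
      (is_derive_cst (r *: ej) (q + t *: ei) ei).
    by rewrite addr0; apply.
  exact: (is_deriveB sh (smooth_derive i Cf U2)).
have [t t01|s s01] := @MVT_line _ _ g q (r *: ei).
  have [d _] := dg _ (sc t t01).
  by rewrite scalerA; have [H _] := derivableZdir r d.
have [ds Es] := dg _ (sc s s01).
rewrite scalerA; have [_ ->] := derivableZdir r ds; rewrite Es /g.
set p := q + (s * r) *: ei.
have Cif := smooth_pderiv i Cf.
have [t t01|t t01] := @MVT_line _ _ (pderiv i f) p (r *: ej).
  rewrite scalerA; have [d _] := smooth_derive j Cif (HU _ _ (sc s s01) (sc t t01)).
  by have [H _] := derivableZdir r d.
rewrite scalerA.
have [d _] := smooth_derive j Cif (HU _ _ (sc s s01) (sc t t01)).
have [_ ->] := derivableZdir r d => -> E.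
by exists (s * r), (t * r); split; [exact: sc | exact: sc | exact: E].
Qed.

(** The second difference over a small square is symmetric in i and j, and equals r^2 times either
    mixed derivative at some point of the square. Continuity at q then forces the two mixed
    derivatives to agree. *)
Lemma pderivC i j : pderiv i (pderiv j f) q = pderiv j (pderiv i f) q.
Proof.
have c k l : {for q, continuous (pderiv k (pderiv l f))}.
  exact: smooth_cont (smooth_pderiv k (smooth_pderiv l Cf)) Uq.
apply/eqP; rewrite -subr_eq0 -normr_le0; apply/ler_addgt0Pl => e e0; rewrite addr0.
have e2 : 0 < e / 2 by rewrite divr_gt0.
have nb k l : \forall p \near q, `|pderiv k (pderiv l f) q - pderiv k (pderiv l f) p| <= e / 2.
  exact: (cvgrPdist_le _ _).1 (c k l) _ e2.
have /nbhs_ballP [r0 /= r00 rb] : nbhs q (U `&` ([set p |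
    `|pderiv i (pderiv j f) q - pderiv i (pderiv j f) p| <= e / 2] `&` [set p |
    `|pderiv j (pderiv i f) q - pderiv j (pderiv i f) p| <= e / 2])).
  apply: (@filterI _ _ (nbhs_filter q)); first exact: open_nbhs_nbhs.
  by apply: (@filterI _ _ (nbhs_filter q)); exact: nb.
(* Two steps of length at most r keep the square strictly inside the ball, as 2r < r0. *)
pose r := r0 / 3.
have r_gt0 : 0 < r by rewrite divr_gt0.
have HB k l (s t : R) : 0 <= s <= r -> 0 <= t <= r ->
    ball q r0 (q + s *: ebase R k + t *: ebase R l).
  move=> /andP[s0 sr] /andP[t0 tr]; rewrite -ball_normE /ball_ /= -addrA opprD addNKr normrN.
  have b (w : R) (a : 'I_n) : 0 <= w <= r -> `|w *: ebase R a| <= r.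
    move=> /andP[w0 wr]; rewrite normrZ ger0_norm //.
    rewrite (le_trans _ wr) // ler_piMr //; apply: mx_norm_leP => // x y.
    by rewrite !mxE; case: (_ && _); rewrite ?normr1 ?normr0.
  apply: le_lt_trans (ler_normD _ _) _.
  have bs := b s k; have bt := b t l; rewrite s0 sr in bs; rewrite t0 tr in bt.
  apply: le_lt_trans (lerD (bs isT) (bt isT)) _; rewrite /r; lra.
have [s [t [s0 t0 E1]]] := second_difference r_gt0
  (fun s t hs ht => (rb _ (HB i j s t hs ht)).1).
have [s' [t' [s0' t0' E2]]] := second_difference r_gt0
  (fun s t hs ht => (rb _ (HB j i s t hs ht)).1).
have E : pderiv j (pderiv i f) (q + s *: ebase R i + t *: ebase R j) =
         pderiv i (pderiv j f) (q + s' *: ebase R j + t' *: ebase R i).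
  have rn : r != 0 by rewrite gt_eqF.
  apply: (mulfI rn); apply: (mulfI rn); apply: etrans (esym E1) (etrans _ E2).
  rewrite (addrAC q (r *: ebase R j)).
  have K (x y z w : R) : x - y - (z - w) = x - z - (y - w) by ring.
  exact: K.
have [_ [_ H1]] := rb _ (HB i j s t s0 t0).
have [_ [H2 _]] := rb _ (HB j i s' t' s0' t0').
rewrite /= in H1 H2; rewrite E in H1.
rewrite -(subrKA (pderiv i (pderiv j f) (q + s' *: ebase R j + t' *: ebase R i))).
apply: le_trans (ler_normD _ _) _; rewrite [leRHS]splitr.
by apply: lerD; [exact: H2 | rewrite distrC; exact: H1].
Qed.

End Schwarz.

Lemma pderiv_val (R : realType) n (W : normedModType R) (f : 'rV[R]_n -> W) j q d :
  is_derive q (ebase R j) f d -> pderiv j f q = d.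
Proof. by case. Qed.

Lemma pderiv_coord (R : realType) n m U (F : 'rV[R]_n -> 'rV[R]_m) j q i :
  smooth_on U F -> U q -> pderiv j F q 0 i = pderiv j (fun p => F p 0 i) q.
Proof. by move=> CF Uq; have [_ H] := is_derive_coord i (smooth_derive j CF Uq); rewrite -H. Qed.

Lemma pderivC_row (R : realType) n m U (F : 'rV[R]_n -> 'rV[R]_m) q i j :
  open U -> smooth_on U F -> U q ->
  pderiv i (pderiv j F) q = pderiv j (pderiv i F) q.
Proof.
move=> oU CF Uq; apply/rowP => k.
have E a b : pderiv a (pderiv b F) q 0 k = pderiv a (pderiv b (fun p => F p 0 k)) q.
  rewrite (pderiv_coord _ _ (smooth_pderiv b CF) Uq).
  have D := smooth_derive a (smooth_pderiv b (smooth_coord k oU CF)) Uq.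
  have FE p : U p -> pderiv b (fun p => F p 0 k) p = pderiv b F p 0 k.
    by move=> Up; rewrite (pderiv_coord _ _ CF Up).
  by have [_ H] := is_derive_eq_on oU Uq FE D.
apply: etrans (E i j) (etrans _ (esym (E j i))).
exact: (pderivC oU (smooth_coord k oU CF) Uq).
Qed.

(** * Charts and the second fundamental form *)

Section charts.
Context {R : realType} {n : nat} {M : topologicalType}.
Implicit Types c d : chart R n M.

Lemma cimg_cmap c p : cdom c p -> cimg c (cmap c p).
Proof. by move=> cp; exists p. Qed.

Lemma cinvK c q : cimg c q -> cdom c (cinv c q) /\ cmap c (cinv c q) = q.
Proof. by move=> [p cp <-]; rewrite cmapK. Qed.

Lemma open_cimg c : open (cimg c).
Proof. exact: cimg_open. Qed.

Lemma overlap_open c d : open (cmap c @` (cdom c `&` cdom d)).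
Proof.
rewrite openE => q [p [cp dp] <-].
have Uq := cimg_cmap cp.
have n1 : nbhs (cmap c p) (cimg c).
  by apply: open_nbhs_nbhs; split=> //; exact: cimg_open.
have n2 : nbhs (cmap c p) (cinv c @^-1` cdom d).
  apply: (cinv_cont Uq); rewrite cmapK //.
  by apply: open_nbhs_nbhs; split=> //; exact: cdom_open.
apply: (@filterS _ _ (nbhs_filter (cmap c p)) (cimg c `&` (cinv c @^-1` cdom d))).
  by move=> r [/cinvK[H1 H2] H3]; exists (cinv c r).
exact: filterI.
Qed.

End charts.
Arguments open_cimg {R n M} c.
Arguments overlap_open {R n M} c d.

(** * The Euclidean inner product and positive definite matrices *)

Lemma dotC (R : realType) m (u v : 'rV[R]_m) : dot u v = dot v u.
Proof. by apply: eq_bigr => i _; rewrite mulrC. Qed.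

Lemma dotDl (R : realType) m (u v w : 'rV[R]_m) : dot (u + v) w = dot u w + dot v w.
Proof. by rewrite -big_split; apply: eq_bigr => i _; rewrite mxE mulrDl. Qed.

Lemma dotZl (R : realType) m (a : R) (u w : 'rV[R]_m) : dot (a *: u) w = a * dot u w.
Proof. by rewrite /dot mulr_sumr; apply: eq_bigr => i _; rewrite mxE mulrA. Qed.

Lemma dotDr (R : realType) m (u v w : 'rV[R]_m) : dot w (u + v) = dot w u + dot w v.
Proof. by rewrite dotC dotDl !(dotC w). Qed.

Lemma dotZr (R : realType) m (a : R) (u w : 'rV[R]_m) : dot w (a *: u) = a * dot w u.
Proof. by rewrite dotC dotZl dotC. Qed.

Lemma dot0l (R : realType) m (w : 'rV[R]_m) : dot 0 w = 0.
Proof. by rewrite -(scale0r w) dotZl mul0r. Qed.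

Lemma dotNl (R : realType) m (u w : 'rV[R]_m) : dot (- u) w = - dot u w.
Proof. by rewrite -scaleN1r dotZl mulN1r. Qed.

Lemma dotNr (R : realType) m (u w : 'rV[R]_m) : dot w (- u) = - dot w u.
Proof. by rewrite dotC dotNl dotC. Qed.

Lemma dot_suml (R : realType) m n (u : 'I_n -> 'rV[R]_m) w :
  dot (\sum_i u i) w = \sum_i dot (u i) w.
Proof. exact: (big_morph (fun v => dot v w) (fun u v => dotDl u v w) (dot0l w)). Qed.

Lemma dot_mulmx (R : realType) m (u v : 'rV[R]_m) : dot u v = (u *m v^T) 0 0.
Proof. by rewrite mxE; apply: eq_bigr => i _; rewrite mxE. Qed.

Lemma dot_ge0 (R : realType) m (u : 'rV[R]_m) : 0 <= dot u u.
Proof. by apply: sumr_ge0 => i _; exact: sqr_ge0. Qed.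

Lemma dot_eq0 (R : realType) m (u : 'rV[R]_m) : dot u u = 0 -> u = 0.
Proof.
move=> /eqP; rewrite psumr_eq0; last by move=> i _; exact: sqr_ge0.
move=> /allP H; apply/rowP => i; rewrite mxE.
by have := H i (mem_index_enum i); rewrite mulf_eq0 orbb => /eqP.
Qed.

Lemma dot_gt0 (R : realType) m (u : 'rV[R]_m) : u != 0 -> 0 < dot u u.
Proof.
rewrite lt_neqAle dot_ge0 andbT; apply: contra_neq => H.
exact: dot_eq0 (esym H).
Qed.

Lemma pos_def_unitmx (R : realType) n (G : 'M[R]_n) :
  (forall u : 'rV[R]_n, u != 0 -> 0 < (u *m G *m u^T) 0 0) -> G \in unitmx.
Proof.
move=> H; rewrite -row_free_unit; apply/row_freeP.
have : row_free G.
  apply: inj_row_free => u uG; apply: contraPeq (uG) => u0 uG0.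
  by have := H u u0; rewrite uG0 mul0mx mxE ltxx.
by move/row_freeP.
Qed.

Lemma ebase_form (R : realType) n (G : 'M[R]_n) a b :
  (ebase R a *m G *m (ebase R b)^T) 0 0 = G a b.
Proof. by rewrite /ebase -rowE trmx_delta -colE !mxE. Qed.

(** Why a metric trace does not depend on the chart: S changes covariantly through J, and its
    factors J can be moved onto the inverse metric A. *)
Lemma trace_congruence (R : realType) n (A J S S' : 'M[R]_n) :
  S = J *m S' *m J^T -> \tr (A *m S^T) = \tr (J^T *m A *m J *m S'^T).
Proof.
by move=> ->; rewrite !trmx_mul trmxK !mulmxA mxtrace_mulC !mulmxA.
Qed.

(** * Isometric immersions in local coordinates *)

Section immersed.
Context {R : realType} {n m : nat} {M : smooth_manifold R n}.
Variables (g : riemannian_metric M) (x : M -> 'rV[R]_m).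
Hypothesis hx : isometric_immersion g x.

Definition frame (c : chart R n M) (q : 'rV[R]_n) : 'M[R]_(n, m) :=
  \matrix_(a, i) pderiv a (x \o cinv c) q 0 i.

Lemma row_frame c q a : row a (frame c q) = pderiv a (x \o cinv c) q.
Proof. by apply/rowP => i; rewrite !mxE. Qed.

Lemma chart_smooth c : atlas M c -> smooth_on (cimg c) (x \o cinv c).
Proof. by have [[sx _] _] := hx => /sx. Qed.

Lemma gmat_dot c q a b : atlas M c -> cimg c q ->
  gmat g c q a b = dot (pderiv a (x \o cinv c) q) (pderiv b (x \o cinv c) q).
Proof.
move=> Mc [p cp <-]; have [_ iso] := hx.
by have := iso c p (ebase R a) (ebase R b) Mc cp; rewrite /metric_at ebase_form => <-.
Qed.

Lemma gmat_frame c q : atlas M c -> cimg c q -> gmat g c q = frame c q *m (frame c q)^T.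
Proof.
move=> Mc cq; apply/matrixP => a b; rewrite gmat_dot // mxE.
by apply: eq_bigr => i _; rewrite !mxE.
Qed.

Lemma gmat_unit c q : atlas M c -> cimg c q -> gmat g c q \in unitmx.
Proof. by move=> Mc cq; apply: pos_def_unitmx => u u0; exact: gmat_pos. Qed.

Lemma ginv_sym c q : atlas M c -> cimg c q -> (ginv g c q)^T = ginv g c q.
Proof. by move=> Mc cq; rewrite /ginv trmx_inv gmat_sym. Qed.

(** The normal projection as a matrix acting on row vectors from the right, so that statements about
    [normal_part] become matrix products. *)
Definition nproj c q : 'M[R]_m :=
  1%:M - (frame c q)^T *m ginv g c q *m frame c q.

Lemma normal_partE c p v : atlas M c -> cdom c p ->
  normal_part g x c p v = v *m nproj c (cmap c p).
Proof.
move=> Mc cp; have cq := cimg_cmap cp.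
rewrite /normal_part /nproj mulmxBr mulmx1; congr (_ - _).
rewrite -(ginv_sym Mc cq) !mulmxA; set q := cmap c p.
rewrite [RHS]mulmx_sum_row; apply: eq_bigr => a _.
rewrite row_frame -scaler_suml; congr (_ *: _).
rewrite mxE; apply: eq_bigr => b _; rewrite [(ginv _ _ _)^T b a]mxE mulrC; congr (_ * _); last by rewrite ginv_sym.
by rewrite mxE; apply: eq_bigr => i _; rewrite !mxE.
Qed.

Lemma frame_nproj c q : atlas M c -> cimg c q -> frame c q *m nproj c q = 0.
Proof.
move=> Mc cq; rewrite mulmxBr mulmx1 !mulmxA -gmat_frame // mulmxV ?gmat_unit //.
by rewrite mul1mx subrr.
Qed.

Lemma nproj_frame c q : atlas M c -> cimg c q -> nproj c q *m (frame c q)^T = 0.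
Proof.
move=> Mc cq; rewrite mulmxBl mul1mx -!mulmxA -gmat_frame // mulVmx ?gmat_unit //.
by rewrite mulmx1 subrr.
Qed.

Lemma tangent_nproj c q a : atlas M c -> cimg c q ->
  pderiv a (x \o cinv c) q *m nproj c q = 0.
Proof. by move=> Mc cq; rewrite -row_frame -row_mul frame_nproj // row0. Qed.

Lemma dot_nproj c q v a : atlas M c -> cimg c q ->
  dot (v *m nproj c q) (pderiv a (x \o cinv c) q) = 0.
Proof.
move=> Mc cq; have Z : nproj c q *m (row a (frame c q))^T = 0.
  by rewrite tr_row colE mulmxA nproj_frame // mul0mx.
by rewrite dot_mulmx -row_frame -mulmxA Z mulmx0 mxE.
Qed.

Lemma nproj_normal c q v : (forall a, dot v (pderiv a (x \o cinv c) q) = 0) ->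
  v *m nproj c q = v.
Proof.
move=> H; rewrite mulmxBr mulmx1 !mulmxA (_ : v *m _ = 0) ?mul0mx ?subr0 //.
apply/rowP => a; rewrite !mxE -[RHS](H a); apply: eq_bigr => i _.
by rewrite !mxE.
Qed.

Definition hessian_vector (c : chart R n M) (q : 'rV[R]_n) (j k : 'I_n) : 'rV[R]_m := pderiv j (pderiv k (x \o cinv c)) q.

Lemma hessian_vectorC c q j k : atlas M c -> cimg c q ->
  hessian_vector c q j k = hessian_vector c q k j.
Proof.
by move=> Mc cq; exact: (pderivC_row j k (open_cimg c) (chart_smooth Mc) cq).
Qed.

Lemma pderiv_gmat c q j a b : atlas M c -> cimg c q ->
  pderiv j (fun q' => gmat g c q' a b) q =
  dot (hessian_vector c q j a) (pderiv b (x \o cinv c) q) +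
  dot (pderiv a (x \o cinv c) q) (hessian_vector c q j b).
Proof.
move=> Mc cq; have Sx := chart_smooth Mc.
have D := is_derive_dot (smooth_derive j (smooth_pderiv a Sx) cq)
                        (smooth_derive j (smooth_pderiv b Sx) cq).
have E q' : cimg c q' -> dot (pderiv a (x \o cinv c) q') (pderiv b (x \o cinv c) q') =
    gmat g c q' a b by move=> cq'; rewrite gmat_dot.
by have [_ H] := is_derive_eq_on (open_cimg c) cq E D; rewrite -H.
Qed.

(* In terms of g_ab = <d_a x, d_b x>, four of the six terms of the Koszul formula
   cancel by symmetry of the second derivatives of x. *)
Lemma christoffelE c q l j k : atlas M c -> cimg c q ->
  christoffel g c l j k q =
  \sum_s ginv g c q l s * dot (hessian_vector c q j k) (pderiv s (x \o cinv c) q).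
Proof.
move=> Mc cq; pose h a b r := dot (hessian_vector c q a b) (pderiv r (x \o cinv c) q).
have Eg a b r : pderiv a (fun q' => gmat g c q' b r) q = h a b r + h a r b.
  by apply: etrans (pderiv_gmat a b r Mc cq) _; congr (_ + _); exact: dotC.
have Eh a b r : h a b r = h b a r by rewrite /h hessian_vectorC.
rewrite /christoffel mulr_sumr; apply: eq_bigr => s _.
rewrite !Eg -/(h j k s) (Eh k j) (Eh s j) (Eh s k).
move: (h j k s) (h j s k) (h k s j) (ginv _ _ _ _ _) => A B C D.
by field.
Qed.

Lemma dmap_ebase c p a :
  dmap x c p (ebase R a) = pderiv a (x \o cinv c) (cmap c p).
Proof. by []. Qed.

(** The Gauss formula, one coordinate at a time: by [christoffelE] the Christoffel correction in the
    Hessian is exactly the tangential part removed by [normal_part]. *)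
Lemma hessian_coord c p i j k : atlas M c -> cdom c p ->
  hessian g c (fun p => x p 0 i) p j k = second_fundamental_form g x c p j k 0 i.
Proof.
move=> Mc cp; have cq := cimg_cmap cp; set q := cmap c p in cq *.
have Sx := chart_smooth Mc.
rewrite mxE -/q /second_fundamental_form /normal_part [RHS]mxE [X in _ = _ + X]mxE -/q.
congr (_ - _).
  rewrite (pderiv_coord _ _ (smooth_pderiv k Sx) cq).
  have D := smooth_derive j (smooth_pderiv k (smooth_coord i (open_cimg c) Sx)) cq.
  have E r : cimg c r -> pderiv k (fun r => (x \o cinv c) r 0 i) r =
      pderiv k (x \o cinv c) r 0 i by move=> cr; rewrite (pderiv_coord _ _ Sx cr).
  by have [_ H] := is_derive_eq_on (open_cimg c) cq E D.
rewrite summxE; apply: eq_bigr => l _.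
have -> := christoffelE l j k Mc cq.
rewrite mulr_suml [RHS]summxE; apply: eq_bigr => s _; rewrite [RHS]mxE.
rewrite !dmap_ebase -/(hessian_vector c q j k); congr (_ * _).
exact: esym (pderiv_coord l i Sx cq).
Qed.

Lemma second_fundamental_formE c p j k : atlas M c -> cdom c p ->
  second_fundamental_form g x c p j k = hessian_vector c (cmap c p) j k *m nproj c (cmap c p).
Proof. by move=> Mc cp; rewrite /second_fundamental_form normal_partE. Qed.

Lemma second_fundamental_formC c p j k : atlas M c -> cdom c p ->
  second_fundamental_form g x c p j k = second_fundamental_form g x c p k j.
Proof.
move=> Mc cp; rewrite (second_fundamental_formE j k Mc cp).
by rewrite (hessian_vectorC j k Mc (cimg_cmap cp)) -(second_fundamental_formE k j Mc cp).
Qed.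

Lemma laplace_map_trace p :
  laplace_map g x p =
  - trace_form g (chart_at p) p (second_fundamental_form g x (chart_at p) p).
Proof.
have [Mc cp] : atlas M (chart_at p) /\ cdom (chart_at p) p.
  by rewrite /chart_at; case: cid2.
apply/rowP => i; rewrite !mxE; congr (- _).
rewrite summxE; apply: eq_bigr => j _; rewrite mxE summxE; apply: eq_bigr => k _.
by rewrite [RHS]mxE (hessian_coord i k j Mc cp) (second_fundamental_formC k j Mc cp).
Qed.

Section change_of_charts.
Variables (c d : chart R n M) (p : M).
Hypotheses (Mc : atlas M c) (Md : atlas M d) (cp : cdom c p) (dp : cdom d p).

Let V := cmap c @` (cdom c `&` cdom d).
Let phi := cmap d \o cinv c.
Let q := cmap c p.

Lemma transition_smooth : smooth_on V phi.
Proof. exact: atlas_compat. Qed.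

Lemma transitionK r : V r -> cimg c r /\ cimg d (phi r).
Proof.
move=> [s [cs ds] <-]; split; first exact: cimg_cmap.
by rewrite /phi /= cmapK //; exact: cimg_cmap.
Qed.

Lemma overlap_mem : V q.
Proof. by exists p. Qed.

Lemma transition_at : phi q = cmap d p.
Proof. by rewrite /phi /q /= cmapK. Qed.

Definition transition_jacobian r : 'M[R]_n := \matrix_(j, a) pderiv j phi r 0 a.

Lemma pderiv_transition j r : V r ->
  pderiv j (x \o cinv c) r =
  \sum_a pderiv j phi r 0 a *: pderiv a (x \o cinv d) (phi r).
Proof.
move=> Vr; have [cr dr] := transitionK Vr.
have D := smooth_chain (open_cimg d) (chart_smooth Md) dr
            (smooth_derive j transition_smooth Vr).
have E s : V s -> (x \o cinv d) (phi s) = (x \o cinv c) s.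
  by move=> [t [ct dt] <-]; rewrite /phi /= !cmapK.
by have [_ H] := is_derive_eq_on (overlap_open c d) Vr E D.
Qed.

(** The terms with second derivatives of the transition map break tensoriality, but they are
    tangent, so [nproj] removes them in [trace_form_transition]. *)
Lemma hessian_vector_transition j k :
  hessian_vector c q j k =
  \sum_a (pderiv j (fun r => pderiv k phi r 0 a) q *: pderiv a (x \o cinv d) (phi q) +
          pderiv k phi q 0 a *:
            \sum_b pderiv j phi q 0 b *: hessian_vector d (phi q) b a).
Proof.
have Vq := overlap_mem; have [cq dq] := transitionK Vq.
have oV := overlap_open c d.
have D a := is_derive_scale
  (smooth_derive j (smooth_coord a oV (smooth_pderiv k transition_smooth)) Vq)
  (smooth_chain (open_cimg d) (smooth_pderiv a (chart_smooth Md)) dq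
     (smooth_derive j transition_smooth Vq)).
have E s : V s -> \sum_a pderiv k phi s 0 a *: pderiv a (x \o cinv d) (phi s) =
    pderiv k (x \o cinv c) s by move=> Vs; rewrite pderiv_transition.
by have [_ H] := is_derive_eq_on oV Vq E (is_derive_bigsum D).
Qed.

Let J := transition_jacobian q.

Lemma frame_transition : frame c q = J *m frame d (phi q).
Proof.
apply/matrixP => j i; rewrite !mxE (pderiv_transition j overlap_mem) summxE.
by apply: eq_bigr => a _; rewrite !mxE.
Qed.

Lemma ginv_transition : J^T *m ginv g c q *m J = ginv g d (phi q).
Proof.
have [cq dq] := transitionK overlap_mem.
have GE : gmat g c q = J *m gmat g d (phi q) *m J^T.
  by rewrite !gmat_frame // frame_transition trmx_mul !mulmxA.
have Gc := gmat_unit Mc cq; have Gd := gmat_unit Md dq.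
(* The Jacobian is invertible because it is a factor of the invertible matrix [gmat g c q]. *)
have JU : J^T \in unitmx.
  by move: Gc; rewrite GE unitmx_mul => /andP[].
have XG : J^T *m ginv g c q *m J *m gmat g d (phi q) = 1%:M.
  apply: (can_inj (mulmxK JU)); rewrite mul1mx -!mulmxA [J *m _]mulmxA -GE.
  by rewrite mulVmx // mulmx1.
by rewrite -[LHS](mulmxK Gd) XG mul1mx.
Qed.

Lemma nproj_transition : nproj c q = nproj d (phi q).
Proof.
rewrite /nproj -ginv_transition frame_transition trmx_mul.
by rewrite !mulmxA.
Qed.

Lemma trace_form_trE (e : chart R n M) (h : 'I_n -> 'I_n -> 'rV[R]_m) i :
  trace_form g e p h 0 i =
  \tr (ginv g e (cmap e p) *m (\matrix_(j, k) h j k 0 i)^T).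
Proof.
rewrite summxE; apply: eq_bigr => j _; rewrite summxE mxE.
by apply: eq_bigr => k _; rewrite !mxE.
Qed.

Lemma trace_form_transition :
  trace_form g c p (second_fundamental_form g x c p) =
  trace_form g d p (second_fundamental_form g x d p).
Proof.
have [cq dq] := transitionK overlap_mem.
have E : ginv g d (cmap d p) = J^T *m ginv g c q *m J.
  by rewrite ginv_transition transition_at.
apply/rowP => i.
have Tc := trace_form_trE c (second_fundamental_form g x c p) i.
have Td := trace_form_trE d (second_fundamental_form g x d p) i.
rewrite E in Td; apply: etrans Tc (etrans _ (esym Td)).
apply: trace_congruence.
apply/matrixP => j k; rewrite [LHS]mxE (second_fundamental_formE j k Mc cp) -/q.
rewrite nproj_transition hessian_vector_transition mulmx_suml summxE [RHS]mxE.
apply: eq_bigr => a _; rewrite mulmxDl -!scalemxAl (tangent_nproj a Md dq) scaler0 add0r.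
have JT : J^T a k = pderiv k phi q 0 a by rewrite !mxE.
rewrite [LHS]mxE [LHS]mulrC JT; congr (_ * _).
rewrite mulmx_suml summxE [RHS]mxE; apply: eq_bigr => b _.
have Jb : J j b = pderiv j phi q 0 b by rewrite mxE.
rewrite -scalemxAl [LHS]mxE Jb [in RHS]mxE; congr (_ * _).
by rewrite (second_fundamental_formE b a Md dp) -transition_at.
Qed.

End change_of_charts.

Lemma chart_atP (p : M) : atlas M (chart_at p) /\ cdom (chart_at p) p.
Proof. by rewrite /chart_at; case: cid2. Qed.

(** [mean_curvature] evaluates at p in [chart_at p], a choice with no regularity in p. Expressing it
    in one fixed chart is what allows H to be differentiated. *)
Lemma mean_curvature_chart c p : atlas M c -> cdom c p ->
  mean_curvature g x p = n%:R^-1 *: trace_form g c p (second_fundamental_form g x c p).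
Proof.
move=> Mc cp; have [Md dp] := chart_atP p.
by rewrite /mean_curvature (trace_form_transition Md Mc dp cp).
Qed.

Lemma laplace_map_mean_curvature p : (0 < n)%N ->
  laplace_map g x p = - (n%:R *: mean_curvature g x p).
Proof.
move=> n0; rewrite laplace_map_trace /mean_curvature scalerA mulfV ?scale1r //.
by rewrite pnatr_eq0 -lt0n.
Qed.

Lemma mean_curvature_normal c p a : atlas M c -> cdom c p ->
  dot (mean_curvature g x p) (pderiv a (x \o cinv c) (cmap c p)) = 0.
Proof.
move=> Mc cp; have cq := cimg_cmap cp.
rewrite (mean_curvature_chart Mc cp) dotZl dot_suml big1 ?mulr0 // => j _.
rewrite dot_suml big1 // => k _.
by rewrite dotZl (second_fundamental_formE j k Mc cp) (dot_nproj _ _ Mc cq) mulr0.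
Qed.

End immersed.

(** * The shape operator in the direction of the mean curvature vector *)

Section shape_operator_algebra.
Context {R : realType}.

(* The symmetric matrix b is the second fundamental form in the direction of H,
   w the differential of u = |H|^2.  The hypotheses k00, k01, k11 read
   b G^-1 b = c^2/4 G - dw dw^T / 4u, and the Cayley-Hamilton theorem for
   b G^-1, whose trace is 2u, makes b a combination of G and dw dw^T. *)
Lemma shape_operator_solve (g00 g01 g11 b00 b01 b11 w0 w1 u c dt : R) :
  dt = g00 * g11 - g01 * g01 -> 0 < dt -> 0 < g00 -> 0 < u -> 0 < c ->
  g11 * b00 - 2 * g01 * b01 + g00 * b11 = 2 * dt * u ->
  g11 * b00 * b00 - 2 * g01 * b00 * b01 + g00 * b01 * b01 =
    dt * (c ^+ 2 / 4 * g00 - w0 * w0 / (4 * u)) ->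
  g11 * b00 * b01 - g01 * (b01 * b01 + b00 * b11) + g00 * b01 * b11 =
    dt * (c ^+ 2 / 4 * g01 - w0 * w1 / (4 * u)) ->
  g11 * b01 * b01 - 2 * g01 * b01 * b11 + g00 * b11 * b11 =
    dt * (c ^+ 2 / 4 * g11 - w1 * w1 / (4 * u)) ->
  [/\ b00 = c / 2 * g00 - w0 * w0 / (8 * u ^+ 2),
      b01 = c / 2 * g01 - w0 * w1 / (8 * u ^+ 2),
      b11 = c / 2 * g11 - w1 * w1 / (8 * u ^+ 2) &
      g11 * w0 * w0 - 2 * g01 * w0 * w1 + g00 * w1 * w1 =
        8 * u ^+ 2 * dt * (c - 2 * u)].
Proof.
move=> dtE dt0 g0 u0 c0 tr k00 k01 k11.
have dtn : dt != 0 by rewrite gt_eqF.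
have un : u != 0 by rewrite gt_eqF.
pose delta := b00 * b11 - b01 * b01.
(* Cayley-Hamilton, multiplied by dt, equates the right-hand sides of [k00], [k01], [k11] with 2 dt
   u b - delta g. Solving for b makes l the coefficient of g. *)
pose l := (dt * (c ^+ 2 / 4) + delta) / (2 * dt * u).
have CH (b g k w : R) : dt * (c ^+ 2 / 4 * g - w / (4 * u)) = 2 * dt * u * b - delta * g ->
    b = l * g - w / (8 * u ^+ 2).
  move=> H; have -> : l * g = (2 * dt * u * b + dt * (w / (4 * u))) / (2 * dt * u).
    rewrite /l mulrAC; congr (_ / _).
    transitivity (dt * (c ^+ 2 / 4 * g - w / (4 * u)) + delta * g + dt * (w / (4 * u))).
      by ring.
    by rewrite H; ring.
  by field; rewrite dtn un.
have e00 : b00 = l * g00 - w0 * w0 / (8 * u ^+ 2).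
  by apply: CH => //; rewrite -k00 -tr /delta; ring.
have e01 : b01 = l * g01 - w0 * w1 / (8 * u ^+ 2).
  by apply: CH => //; rewrite -k01 -tr /delta; ring.
have e11 : b11 = l * g11 - w1 * w1 / (8 * u ^+ 2).
  by apply: CH => //; rewrite -k11 -tr /delta; ring.
(* W is dt times the squared length of grad u. *)
pose W := g11 * w0 * w0 - 2 * g01 * w0 * w1 + g00 * w1 * w1.
have WE : W = 16 * u ^+ 2 * dt * (l - u).
  have : 2 * dt * u = 2 * l * dt - W / (8 * u ^+ 2).
    by rewrite -tr e00 e01 e11 /W dtE; field.
  move=> H; have -> : W = 8 * u ^+ 2 * (2 * l * dt - (2 * l * dt - W / (8 * u ^+ 2))).
    by field.
  by rewrite -H; ring.
have dE : delta = dt * (2 * l * u - l ^+ 2).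
  transitivity (l ^+ 2 * dt - l * W / (8 * u ^+ 2)).
    by rewrite /delta e00 e01 e11 /W dtE; field.
  by rewrite WE; field.
(* The determinant delta is known twice, from the definition of l and from the formula for b;
   comparing leaves only l^2. *)
have l2 : l ^+ 2 = (c / 2) ^+ 2.
  have H : 2 * dt * u * l = dt * (c ^+ 2 / 4) + delta.
    by rewrite /l; field; rewrite dtn un.
  rewrite dE in H; apply: (mulfI dtn).
  transitivity (dt * (c ^+ 2 / 4) + dt * (2 * l * u - l ^+ 2) - 2 * dt * u * l + dt * l ^+ 2).
    by rewrite -H; ring.
  by field.
have W0 : 0 <= W.
  rewrite -(pmulr_rge0 _ g0).
  have -> : g00 * W = (g00 * w1 - g01 * w0) ^+ 2 + dt * w0 ^+ 2.
    by rewrite /W dtE; ring.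
  by rewrite addr_ge0 ?sqr_ge0 // mulr_ge0 ?sqr_ge0 // ltW.
have lu : 0 <= l - u.
  move: W0; rewrite WE pmulr_rge0 //.
  by rewrite mulr_gt0 // mulr_gt0 // exprn_gt0.
(* The sign is settled by W >= 0, which gives l >= u > 0. *)
have lc : l = c / 2.
  move/eqP: l2; rewrite eqf_sqr => /orP[/eqP //|/eqP H].
  by exfalso; move: lu u0 c0; rewrite H; lra.
split; [by rewrite e00 lc | by rewrite e01 lc | by rewrite e11 lc |].
by rewrite -/W WE lc; field.
Qed.

(** Here B, s, a, f, h, k are the products F1.F1, F1.F2, F.F1, F.F2, H.F2, H.F1, and phi is the
    factor with F1.y_i = phi w_i. All hypotheses but the last determine these as rational functions
    of u; put into the last one, they leave a nonzero multiple of c^2 (c + 4u). *)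
Lemma final_contradiction (c u B s a f h k phi : R) :
  0 < u -> 0 < c -> 0 < c - 2 * u ->
  32 * u ^+ 4 * (c - 2 * u) * B = 3 * c ^+ 2 ->
  (4 * u ^+ 3 * (c - 2 * u) - 2 * u ^+ 4) * B + 2 * u ^+ 4 * (c - 2 * u) * s = 0 ->
  8 * u ^+ 3 * a = - c -> 3 * u ^+ 2 * a + u ^+ 3 * (B + f) = 0 ->
  16 * u ^+ 2 * k = - c -> 2 * u * k + u ^+ 2 * (- (c / 2) * phi + a + h) = 0 ->
  32 * u ^+ 3 * (c - 2 * u) * phi = - 3 * c ->
  2 * u ^+ 2 * (c - 2 * u) * s + 2 * u * c * f - c * h = 0 -> False.
Proof.
move=> u0 c0 v0; set v := c - 2 * u in v0 *.
have un : u != 0 by rewrite gt_eqF.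
have vn : v != 0 by rewrite gt_eqF.
have solve (p q r : R) : p != 0 -> p * q = r -> q = r / p.
  by move=> pn <-; rewrite mulrAC mulfV // mul1r.
have P (n k' : nat) : (n.+1%:R * u ^+ k' != 0 :> R).
  by rewrite mulf_neq0 ?pnatr_eq0 // expf_neq0.
move=> /(solve _ _ _ (mulf_neq0 (P _ _) vn)) BE H1.
move=> /(solve _ _ _ (P _ _)) aE H2 /(solve _ _ _ (P _ _)) kE H3.
move=> /(solve _ _ _ (mulf_neq0 (P _ _) vn)) phE.
have sE : s = - ((4 * u ^+ 3 * v - 2 * u ^+ 4) * B) / (2 * u ^+ 4 * v).
  apply: solve; first by rewrite mulf_neq0.
  by apply/eqP; rewrite -addr_eq0 addrC H1.
have fE : f = - (3 * u ^+ 2 * a + u ^+ 3 * B) / u ^+ 3.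
  apply: solve; first by rewrite expf_neq0.
  by apply/eqP; rewrite -addr_eq0 -H2; apply/eqP; ring.
have hE : h = - (2 * u * k + u ^+ 2 * (- (c / 2) * phi + a)) / u ^+ 2.
  apply: solve; first by rewrite expf_neq0.
  by apply/eqP; rewrite -addr_eq0 -H3; apply/eqP; ring.
have -> : 2 * u ^+ 2 * v * s + 2 * u * c * f - c * h =
    - (c ^+ 2 * (c + 4 * u)) / (64 * u ^+ 3 * v).
  rewrite sE fE hE BE kE phE aE /v; field.
  by rewrite un -/v vn.
move/eqP; rewrite mulf_eq0 invr_eq0 (negbTE (mulf_neq0 (P _ _) vn)) orbF oppr_eq0.
rewrite mulf_eq0 expf_eq0 /= gt_eqF //= gt_eqF //; lra.
Qed.

End shape_operator_algebra.

Lemma ord2P (P : 'I_2 -> Prop) : P ord0 -> P ord_max -> forall i, P i.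
Proof.
move=> P0 P1 [[|[|//]] i2].
  by rewrite (_ : Ordinal i2 = ord0) //; exact: val_inj.
by rewrite (_ : Ordinal i2 = ord_max) //; exact: val_inj.
Qed.

Lemma derive_cst_on (R : realType) (V W : normedModType R) (U : set V)
    (f : V -> W) (k : W) q v d :
  open U -> U q -> (forall p, U p -> f p = k) -> is_derive q v f d -> d = 0.
Proof.
move=> oU Uq fk df.
have kf p : U p -> k = f p by move/fk.
exact: (derive_unique df (is_derive_eq_on oU Uq kf (is_derive_cst k q v))).
Qed.

(* Partial derivatives are sealed so that a failing rewrite does not unfold them
   down to limits of difference quotients. *)
HB.lock Definition dvec (R : realType) n m (F : 'rV[R]_n -> 'rV[R]_m) (a : 'I_n)
  (q : 'rV[R]_n) : 'rV[R]_m := pderiv a F q.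

HB.lock Definition dscal (R : realType) n (f : 'rV[R]_n -> R) (a : 'I_n)
  (q : 'rV[R]_n) : R := pderiv a f q.

Section sealed_derivatives.
Context {R : realType} {n m : nat}.
Implicit Types (F : 'rV[R]_n -> 'rV[R]_m) (f : 'rV[R]_n -> R).

Lemma dvecE F a : dvec F a = pderiv a F.
Proof. by rewrite dvec.unlock. Qed.

Lemma dscalE f a : dscal f a = pderiv a f.
Proof. by rewrite dscal.unlock. Qed.

Lemma dvec_derive U F a q : smooth_on U F -> U q -> is_derive q (ebase R a) F (dvec F a q).
Proof. by rewrite dvecE; exact: smooth_derive. Qed.

Lemma dscal_derive U f a q : smooth_on U f -> U q -> is_derive q (ebase R a) f (dscal f a q).
Proof. by rewrite dscalE; exact: smooth_derive. Qed.

Lemma dvec_val F a q d : is_derive q (ebase R a) F d -> dvec F a q = d.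
Proof. by rewrite dvecE; exact: pderiv_val. Qed.

Lemma dscal_val f a q d : is_derive q (ebase R a) f d -> dscal f a q = d.
Proof. by rewrite dscalE; exact: pderiv_val. Qed.

Lemma dvec_smooth U F a : smooth_on U F -> smooth_on U (dvec F a).
Proof. by rewrite dvecE; exact: smooth_pderiv. Qed.

Lemma dscal_smooth U f a : smooth_on U f -> smooth_on U (dscal f a).
Proof. by rewrite dscalE; exact: smooth_pderiv. Qed.

Lemma dvecC U F a b q : open U -> smooth_on U F -> U q ->
  dvec (dvec F b) a q = dvec (dvec F a) b q.
Proof. by rewrite !dvecE; exact: pderivC_row. Qed.

Lemma dscalC U f a b q : open U -> smooth_on U f -> U q ->
  dscal (dscal f b) a q = dscal (dscal f a) b q.
Proof. by move=> oU Cf Uq; rewrite !dscalE; exact: (pderivC oU Cf Uq). Qed.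

End sealed_derivatives.

Section surface_patch.
Context {R : realType} {m : nat}.
Variables (U : set 'rV[R]_2) (y H : 'rV[R]_2 -> 'rV[R]_m) (c : R).

Definition gram a b q : R := dot (dvec y a q) (dvec y b q).
Definition gdet q : R :=
  gram ord0 ord0 q * gram ord_max ord_max q - gram ord0 ord_max q * gram ord0 ord_max q.
Definition normsq q : R := dot (H q) (H q).

Local Notation g := gram.
Local Notation det := gdet.
Local Notation u := normsq.
Local Notation w := (dscal normsq).

Hypotheses (oU : open U) (Sy : smooth_on U y) (SH : smooth_on U H) (c0 : 0 < c).
Hypothesis det0 : forall q, U q -> 0 < det q.
Hypothesis H0 : forall q, U q -> H q != 0.
Hypothesis H_normal : forall q a, U q -> dot (H q) (dvec y a q) = 0.
(** The definition of H as half a trace, with the determinant cleared. Ambient second derivatives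
    replace the second fundamental form, hence the undetermined tangent vector. *)
Hypothesis H_trace : forall q, U q -> exists t0 t1 : R,
  g ord_max ord_max q *: dvec (dvec y ord0) ord0 q
  - (2 * g ord0 ord_max q) *: dvec (dvec y ord_max) ord0 q
  + g ord0 ord0 q *: dvec (dvec y ord_max) ord_max q =
  (2 * det q) *: H q + (t0 *: dvec y ord0 q + t1 *: dvec y ord_max q).
Hypothesis H_parallel : forall q j, U q -> exists s t0 t1 : R,
  dvec H j q = s *: H q + (t0 *: dvec y ord0 q + t1 *: dvec y ord_max q).
Hypothesis H_homothetic : forall q i j, U q ->
  dot (dvec H i q) (dvec H j q) = c ^+ 2 / 4 * g i j q.

(** The image under dy of the Riemannian gradient of u, with the inverse metric written out by
    cofactors. *)
Definition grad_vector q : 'rV[R]_m :=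
  (det q)^-1 *:
   ((g ord_max ord_max q * w ord0 q - g ord0 ord_max q * w ord_max q) *: dvec y ord0 q
    + (g ord0 ord0 q * w ord_max q - g ord0 ord_max q * w ord0 q) *: dvec y ord_max q).

(** The F of the overview. As H/|H| is parallel, the normal part of dH is du/(2u) H; its tangential
    part is -A_H, where A_H is c/2 minus du grad u/(8u^2). Collecting du gives the two
    coefficients. *)
Definition rate q : 'rV[R]_m := (2 * u q)^-1 *: H q + (8 * u q ^+ 2)^-1 *: grad_vector q.

Lemma normsq_gt0 q : U q -> 0 < u q.
Proof. by move=> Uq; exact: dot_gt0 (H0 Uq). Qed.

Lemma gramC a b q : g a b q = g b a q.
Proof. exact: dotC. Qed.

Lemma grad_vectorE q a : U q -> dot (grad_vector q) (dvec y a q) = w a q.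
Proof.
move=> Uq; rewrite /grad_vector dotZl dotDl.
rewrite (dotZl _ (dvec y ord0 q)) (dotZl _ (dvec y ord_max q)).
have dn : det q != 0 by rewrite gt_eqF // det0.
apply: (mulfI dn); rewrite mulVKf //.
move: a; apply: ord2P; rewrite -!/(gram _ _ q) ?(gramC ord_max ord0) /det; ring.
Qed.

Lemma dot_grad_vector_normal q : U q -> dot (H q) (grad_vector q) = 0.
Proof. by move=> Uq; rewrite /grad_vector dotZr dotDr !dotZr !H_normal // !mulr0 addr0 mulr0. Qed.

Lemma dscal_normsq q j : U q -> w j q = 2 * dot (H q) (dvec H j q).
Proof.
move=> Uq; have D := dvec_derive j SH Uq.
by rewrite (dscal_val (is_derive_dot D D)) dotC; ring.
Qed.

Lemma dot_dvec_tangent q j a : U q ->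
  dot (dvec H j q) (dvec y a q) = - dot (H q) (dvec (dvec y a) j q).
Proof.
move=> Uq; apply/eqP; rewrite -addr_eq0; apply/eqP.
apply: (derive_cst_on oU Uq (fun p Up => H_normal a Up)).
exact: (is_derive_dot (dvec_derive j SH Uq) (dvec_derive j (dvec_smooth a Sy) Uq)).
Qed.

Lemma gram00_gt0 q : U q -> 0 < g ord0 ord0 q.
Proof.
move=> Uq; have := det0 Uq; rewrite /det; have := dot_ge0 (dvec y ord0 q).
rewrite le_eqVlt -/(gram ord0 ord0 q) => /orP[/eqP <-|//].
by rewrite mul0r sub0r oppr_gt0 => /le_lt_trans -/(_ _ (sqr_ge0 _)); rewrite ltxx.
Qed.

Lemma shape_operatorE q : U q ->
  (forall i a, dot (H q) (dvec (dvec y a) i q) =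
     c / 2 * g i a q - w i q * w a q / (8 * u q ^+ 2)) /\
  g ord_max ord_max q * w ord0 q * w ord0 q
    - 2 * g ord0 ord_max q * w ord0 q * w ord_max q
    + g ord0 ord0 q * w ord_max q * w ord_max q =
  8 * u q ^+ 2 * det q * (c - 2 * u q).
Proof.
move=> Uq; pose b i a := dot (H q) (dvec (dvec y a) i q).
have bC i a : b i a = b a i by rewrite /b (dvecC i a oU Sy Uq).
have un : u q != 0 by rewrite gt_eqF // normsq_gt0.
have tr : g ord_max ord_max q * b ord0 ord0 - 2 * g ord0 ord_max q * b ord0 ord_max
    + g ord0 ord0 q * b ord_max ord_max = 2 * det q * u q.
  have [t0 [t1 /(congr1 (dot (H q)))]] := H_trace Uq.
  rewrite !dotDr dotNr !dotZr !H_normal // !mulr0 !addr0 => <-; by [].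
(* The homothety relation with dH split into its normal part, of coefficient w_i/(2u), and its
   tangential part -A_H. What remains is b G^-1 b, multiplied by the determinant. *)
have K i j : g ord_max ord_max q * b i ord0 * b j ord0
    - g ord0 ord_max q * (b i ord_max * b j ord0 + b i ord0 * b j ord_max)
    + g ord0 ord0 q * b i ord_max * b j ord_max =
    det q * (c ^+ 2 / 4 * g i j q - w i q * w j q / (4 * u q)).
  have [s [t0 [t1 E]]] := H_parallel i Uq.
  have sE : s = w i q / (2 * u q).
    rewrite dscal_normsq // E dotDr dotZr dotDr !dotZr !H_normal // !mulr0 !addr0 -/(normsq q).
    by field.
  have Eb a : t0 * g ord0 a q + t1 * g ord_max a q = - b i a.
    rewrite -[RHS]dot_dvec_tangent // E dotDl dotZl H_normal // mulr0 add0r.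
    by rewrite dotDl !dotZl.
  have Hj : dot (H q) (dvec H j q) = w j q / 2 by rewrite dscal_normsq //; field.
  have := H_homothetic i j Uq.
  rewrite E dotDl dotZl Hj sE dotDl !dotZl !(dotC (dvec y _ q)) !dot_dvec_tangent // -!/(b _ _).
  move=> <-.
  have E0 := Eb ord0; have E1 := Eb ord_max.
  have -> : b i ord0 = - (t0 * g ord0 ord0 q + t1 * g ord_max ord0 q) by rewrite E0 opprK.
  have -> : b i ord_max = - (t0 * g ord0 ord_max q + t1 * g ord_max ord_max q) by rewrite E1 opprK.
  rewrite (gramC ord_max ord0) /det; by field.
have [|||||||||] := @shape_operator_solve R (g ord0 ord0 q) (g ord0 ord_max q)
  (g ord_max ord_max q) (b ord0 ord0) (b ord0 ord_max) (b ord_max ord_max)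
  (w ord0 q) (w ord_max q) (u q) c (det q) => //.
- exact: det0.
- exact: gram00_gt0.
- exact: normsq_gt0.
- by rewrite -K; ring.
- by rewrite -K (bC ord_max ord0); ring.
- by rewrite -K (bC ord_max ord0); ring.
move=> e00 e01 e11 W; split=> // i a.
have F (i' a' : 'I_2) : b i' a' = c / 2 * g i' a' q - w i' q * w a' q / (8 * u q ^+ 2).
  move: i' a'; apply: ord2P; apply: ord2P; rewrite ?e00 ?e01 ?e11 //.
  by rewrite bC e01 (gramC ord_max ord0) (mulrC (w ord_max q)).
exact: F.
Qed.

Lemma dvec_mean_curvature q j : U q -> dvec H j q = - (c / 2) *: dvec y j q + w j q *: rate q.
Proof.
move=> Uq; have un : u q != 0 by rewrite gt_eqF // normsq_gt0.
have [s [t0 [t1 E]]] := H_parallel j Uq.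
have sE : s = w j q / (2 * u q).
  rewrite dscal_normsq // E dotDr dotZr dotDr !dotZr !H_normal // !mulr0 !addr0 -/(normsq q).
  by field.
set X := - (c / 2) *: dvec y j q + w j q *: rate q.
have TX a : dot (dvec H j q - X) (dvec y a q) = 0.
  rewrite dotDl dotNl /X /rate dotDl (dotZl _ (dvec y j q)) (dotZl _ (_ + _)) dotDl.
  rewrite (dotZl _ (H q)) (dotZl _ (grad_vector q)) grad_vectorE // H_normal //.
  rewrite dot_dvec_tangent // (shape_operatorE Uq).1 -/(gram j a q).
  by field.
(* The multiples of H cancel, so the difference is tangent; by [TX] it is also orthogonal to the
   tangent plane, hence zero. *)
have [r0 [r1 XE]] : exists r0 r1 : R,
    dvec H j q - X = r0 *: dvec y ord0 q + r1 *: dvec y ord_max q.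
  have [k0 [k1 kE]] : exists k0 k1 : R,
      grad_vector q = k0 *: dvec y ord0 q + k1 *: dvec y ord_max q.
    by rewrite /grad_vector scalerDr !scalerA; eexists; eexists.
  have [l0 [l1 lE]] : exists l0 l1 : R,
      dvec y j q = l0 *: dvec y ord0 q + l1 *: dvec y ord_max q.
    move: {E TX X} j {sE}; apply: ord2P.
      by exists 1, 0; rewrite scale1r scale0r addr0.
    by exists 0, 1; rewrite scale1r scale0r add0r.
  exists (t0 + c / 2 * l0 - w j q / (8 * u q ^+ 2) * k0),
         (t1 + c / 2 * l1 - w j q / (8 * u q ^+ 2) * k1).
  rewrite E sE /X /rate kE; rewrite {1}lE; apply/rowP => i; rewrite !mxE.
  by field.
apply/eqP; rewrite -subr_eq0; apply/eqP/dot_eq0.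
by rewrite {2}XE dotDr !dotZr !TX !mulr0 addr0.
Qed.

Lemma gram_smooth a b : smooth_on U (g a b).
Proof. by apply: smooth_dot => //; exact: dvec_smooth. Qed.

Lemma normsq_smooth : smooth_on U u.
Proof. exact: smooth_dot. Qed.

Lemma gdet_smooth : smooth_on U det.
Proof.
have -> : det = (fun q => g ord0 ord0 q * g ord_max ord_max q +
    (-1) * (g ord0 ord_max q * g ord0 ord_max q)).
  by apply/funext => q; rewrite mulN1r.
by apply: smoothD => //; repeat (apply: smoothM => //); do ?[exact: gram_smooth | exact: smooth_cst].
Qed.

Lemma grad_coef_smooth a b d e :
  smooth_on U (fun q => g a b q * w d q - g ord0 ord_max q * w e q).
Proof.
have -> : (fun q => g a b q * w d q - g ord0 ord_max q * w e q) =
    (fun q => g a b q * w d q + (-1) * (g ord0 ord_max q * w e q)).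
  by apply/funext => q; rewrite mulN1r.
have Sw a' : smooth_on U (w a') by exact: dscal_smooth normsq_smooth.
by apply: smoothD => //; repeat (apply: smoothM => //);
   do ?[exact: gram_smooth | exact: smooth_cst].
Qed.

Lemma rate_smooth : smooth_on U rate.
Proof.
have un q : U q -> u q != 0 by move=> Uq; rewrite gt_eqF // normsq_gt0.
have dn q : U q -> det q != 0 by move=> Uq; rewrite gt_eqF // det0.
have c2 k : smooth_on U (fun _ : 'rV[R]_2 => k%:R : R) by exact: smooth_cst.
apply: smoothD => //; apply: smoothZ => //.
- apply: smoothV => //; last by apply: smoothM => //; exact: normsq_smooth.
  by move=> q Uq; rewrite mulf_neq0 ?pnatr_eq0 // un.
- apply: smoothV => //; last by do !apply: smoothM => //; exact: normsq_smooth.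
  by move=> q Uq; rewrite mulf_neq0 ?pnatr_eq0 // expf_neq0 // un.
- apply: smoothZ => //; first by apply: smoothV => //; exact: gdet_smooth.
  by apply: smoothD => //; apply: smoothZ => //;
     do ?[exact: grad_coef_smooth | exact: dvec_smooth].
Qed.

Lemma dot_normal_rate q : U q -> dot (H q) (rate q) = 2^-1.
Proof.
move=> Uq; have un : u q != 0 by rewrite gt_eqF // normsq_gt0.
rewrite /rate dotDr (dotZr _ (H q)) (dotZr _ (grad_vector q)) dot_grad_vector_normal // mulr0 addr0 -/(normsq q).
by field.
Qed.

Lemma dot_rate_tangent q a : U q -> dot (rate q) (dvec y a q) = w a q / (8 * u q ^+ 2).
Proof.
move=> Uq; rewrite /rate dotDl (dotZl _ (H q)) (dotZl _ (grad_vector q)).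
rewrite grad_vectorE // H_normal // mulr0 add0r.
by rewrite mulrC.
Qed.

Lemma dot_grad_vector q : U q ->
  dot (grad_vector q) (grad_vector q) = 8 * u q ^+ 2 * (c - 2 * u q).
Proof.
move=> Uq; have dn : det q != 0 by rewrite gt_eqF // det0.
rewrite {2}/grad_vector dotZr dotDr !dotZr !grad_vectorE //.
apply: (mulfI dn); rewrite mulVKf // [RHS]mulrC mulrAC mulrC.
have [_ W] := shape_operatorE Uq.
transitivity (8 * u q ^+ 2 * det q * (c - 2 * u q)); last by ring.
by rewrite -W; ring.
Qed.

(** The summands of [rate] are orthogonal and contribute 2u and c - 2u. *)
Lemma dot_rate_rate q : U q -> 8 * u q ^+ 2 * dot (rate q) (rate q) = c.
Proof.
move=> Uq; have un : u q != 0 by rewrite gt_eqF // normsq_gt0.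
rewrite /rate dotDl !dotDr !(dotZl _ (H q)) !(dotZr _ (H q)).
rewrite !(dotZl _ (grad_vector q)) !(dotZr _ (grad_vector q)) dot_grad_vector // (dotC (grad_vector q)).
rewrite dot_grad_vector_normal // -/(normsq q).
by field.
Qed.

End surface_patch.

(** * Points where the mean curvature is not stationary *)

Lemma is_derive_add (R : realType) (V W : normedModType R) (f f' : V -> W) q v d d' :
  is_derive q v f d -> is_derive q v f' d' ->
  is_derive q v (fun p => f p + f' p) (d + d').
Proof. exact: is_deriveD. Qed.

Lemma derive_eq_fun (R : realType) (V W : normedModType R) (U : set V)
    (f f' : V -> W) q v a b :
  open U -> U q -> (forall p, U p -> f p = f' p) ->
  is_derive q v f a -> is_derive q v f' b -> a = b.
Proof.
move=> oU Uq ff df df'; exact: (derive_unique (is_derive_eq_on oU Uq ff df) df').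
Qed.

(** * Maps whose differential is a multiple of du *)

Section parallel_gradients.
Context {R : realType} {m : nat}.
Variables (W : set 'rV[R]_2) (u : 'rV[R]_2 -> R).
Hypotheses (oW : open W) (Su : smooth_on W u).
Hypothesis du_neq0 : forall q, W q ->
  dscal u ord0 q * dscal u ord0 q + dscal u ord_max q * dscal u ord_max q != 0.

Lemma du_cancel q (V : lmodType R) (z : V) :
  W q -> (forall j, dscal u j q *: z = 0) -> z = 0.
Proof.
move=> Wq Z; apply: (scalerI (du_neq0 Wq)).
by rewrite scaler0 scalerDl -!scalerA !Z !scaler0 addr0.
Qed.

(** K is the coordinatewise projection of dG on du. Dividing by the coordinate norm of du, and not
    the Riemannian one, suffices and keeps K smooth. *)
Lemma parallel_factor (G : 'rV[R]_2 -> 'rV[R]_m) : smooth_on W G ->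
  (forall q i j, W q -> dscal u j q *: dvec G i q = dscal u i q *: dvec G j q) ->
  exists2 K, smooth_on W K & forall q i, W q -> dvec G i q = dscal u i q *: K q.
Proof.
move=> SG par.
pose N q := dscal u ord0 q * dscal u ord0 q + dscal u ord_max q * dscal u ord_max q.
exists (fun q => (N q)^-1 *:
  (dscal u ord0 q *: dvec G ord0 q + dscal u ord_max q *: dvec G ord_max q)).
  have Sd a := dscal_smooth a Su.
  apply: smoothZ => //; first apply: smoothV => //.
    by apply: smoothD => //; apply: smoothM => //; exact: Sd.
  by apply: smoothD => //; apply: smoothZ => //; do ?[exact: Sd | exact: dvec_smooth].
move=> q i Wq; have Nn : N q != 0 := du_neq0 Wq.
apply: (scalerI Nn); rewrite [RHS]scalerA [RHS]scalerA.
have -> : N q * dscal u i q * (N q)^-1 = dscal u i q by rewrite mulrAC mulfV // mul1r.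
rewrite /N scalerDl scalerDr -!scalerA (par q i ord0 Wq) (par q i ord_max Wq).
by rewrite !scalerA ![dscal u i q * _]mulrC.
Qed.

(** This is d(du K) = 0: in dG = du K the second derivatives of G and of u are symmetric, so only
    the antisymmetric part of du dK is left, and it vanishes. *)
Lemma factor_parallel (G K : 'rV[R]_2 -> 'rV[R]_m) : smooth_on W G -> smooth_on W K ->
  (forall q i, W q -> dvec G i q = dscal u i q *: K q) ->
  forall q i j, W q -> dscal u j q *: dvec K i q = dscal u i q *: dvec K j q.
Proof.
move=> SG SK GK q i j Wq.
have E a b : dvec (dvec G a) b q =
    dscal (dscal u a) b q *: K q + dscal u a q *: dvec K b q.
  apply: (derive_eq_fun oW Wq (fun p Wp => GK p a Wp)).
    exact: dvec_derive (dvec_smooth a SG) Wq.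
  exact: is_derive_scale (dscal_derive b (dscal_smooth a Su) Wq) (dvec_derive b SK Wq).
have := dvecC j i oW SG Wq; rewrite !E (dscalC j i oW Su Wq).
by move/addrI => ->.
Qed.

Lemma next_derivative (G K : 'rV[R]_2 -> 'rV[R]_m) : smooth_on W G -> smooth_on W K ->
  (forall q i, W q -> dvec G i q = dscal u i q *: K q) ->
  exists2 K', smooth_on W K' & forall q i, W q -> dvec K i q = dscal u i q *: K' q.
Proof.
by move=> SG SK GK; apply: parallel_factor => //; exact: factor_parallel GK.
Qed.

End parallel_gradients.

(** Dictionary: n_ij, c_ij are the products of the second derivatives y_ij with nu and G; z_i, z
    those of Z with y_i and nu; k_i = G1.y_i, h = G.H. The trace is split along the gradient (A, B)
    and along the level direction (w1, -w0): the former part is given by the derivative of the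
    gradient vector, the latter by differentiating the orthogonality of G to the level curves. *)
Lemma trace_identity_algebra (R : realType)
    (g00 g01 g11 w0 w1 w00 w01 w11 n00 n01 n11 c00 c01 c11 z0 z1 k0 k1
     phi z h u c : R) :
  let dt := g00 * g11 - g01 * g01 in
  let A := g11 * w0 - g01 * w1 in
  let B := g00 * w1 - g01 * w0 in
  dt != 0 -> A * w0 + B * w1 != 0 ->
  (w0 * k0 + c00) * w1 + phi * w0 * w01 = (w0 * k1 + c01) * w0 + phi * w1 * w00 ->
  (w1 * k0 + c01) * w1 + phi * w0 * w11 = (w1 * k1 + c11) * w0 + phi * w1 * w01 ->
  n00 = c00 - phi * (w00 - (w0 * z0 + 2 * c * u * g00)) ->
  n01 = c01 - phi * (w01 - (w0 * z1 + 2 * c * u * g01)) ->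
  n01 = c01 - phi * (w01 - (w1 * z0 + 2 * c * u * g01)) ->
  n11 = c11 - phi * (w11 - (w1 * z1 + 2 * c * u * g11)) ->
  dt * (w0 * z) = A * n00 + B * n01 ->
  dt * (w1 * z) = A * n01 + B * n11 ->
  g11 * n00 - 2 * g01 * n01 + g00 * n11 = 2 * dt * h ->
  2 * h = z + 2 * c * u * phi.
Proof.
move=> dt A B dtn Wn p0 p1 e00 e01 e10 e11 x0 x1 tr.
apply: (mulfI dtn); apply: (mulfI Wn).
transitivity (A * (A * n00 + B * n01) + B * (A * n01 + B * n11)
    + dt * (w1 * (w1 * n00 - w0 * n01) - w0 * (w1 * n01 - w0 * n11))).
  rewrite mulrA [X in _ * X]mulrC; transitivity ((A * w0 + B * w1) * (2 * dt * h)); first by ring.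
  by rewrite -tr /A /B /dt; ring.
rewrite -x0 -x1.
have -> : w1 * (w1 * n00 - w0 * n01) - w0 * (w1 * n01 - w0 * n11) =
    (A * w0 + B * w1) * (2 * c * u * phi).
  have E0 : w1 * c00 - w0 * c01 = phi * w1 * w00 - phi * w0 * w01 + w0 * w0 * k1 - w0 * w1 * k0.
    transitivity ((w0 * k0 + c00) * w1 + phi * w0 * w01 - w0 * c01 - w0 * k0 * w1 - phi * w0 * w01); first by ring.
    by rewrite p0; ring.
  have E1 : w1 * c01 - w0 * c11 = phi * w1 * w01 - phi * w0 * w11 + w1 * w0 * k1 - w1 * w1 * k0.
    transitivity ((w1 * k0 + c01) * w1 + phi * w0 * w11 - w0 * c11 - w1 * k0 * w1 - phi * w0 * w11); first by ring.
    by rewrite p1; ring.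
  have F0 : w1 * n00 - w0 * n01 = w1 * c00 - w0 * c01
      - phi * (w1 * w00 - w0 * w01) + phi * (w0 * w1 * z0 - w0 * w0 * z1)
      + phi * 2 * c * u * (w1 * g00 - w0 * g01).
    by rewrite e00 e01; ring.
  have F1 : w1 * n01 - w0 * n11 = w1 * c01 - w0 * c11
      - phi * (w1 * w01 - w0 * w11) + phi * (w1 * w1 * z0 - w0 * w1 * z1)
      + phi * 2 * c * u * (w1 * g01 - w0 * g11).
    by rewrite e10 e11; ring.
  by rewrite F0 F1 E0 E1 /A /B; ring.
by ring.
Qed.

Lemma dot_normal_combination (R : realType) m (t z e e0 e1 d0 d1 nu : 'rV[R]_m)
    (s k a b s0 s1 A B : R) :
  s *: t + k *: (a *: z + b *: e) = s0 *: e0 + A *: d0 + (s1 *: e1 + B *: d1) ->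
  dot t nu = 0 -> dot e nu = 0 -> dot e0 nu = 0 -> dot e1 nu = 0 ->
  k * (a * dot z nu) = A * dot d0 nu + B * dot d1 nu.
Proof.
move=> /(congr1 (fun v => dot v nu)); rewrite !(dotDl, dotZl) => E t0 f0 f1 f2.
by move: E; rewrite t0 f0 f1 f2 !mulr0 addr0 !add0r.
Qed.

Section nonconstant_mean_curvature.
Context {R : realType} {m : nat}.
Variables (W : set 'rV[R]_2) (y H F : 'rV[R]_2 -> 'rV[R]_m) (c : R).

Local Notation g := (gram y).
Local Notation det := (gdet y).
Local Notation u := (normsq H).
Local Notation w := (dscal (normsq H)).

Hypotheses (oW : open W) (Sy : smooth_on W y) (SH : smooth_on W H)
           (SF : smooth_on W F) (c0 : 0 < c).
Hypothesis det0 : forall q, W q -> 0 < det q.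
Hypothesis u0 : forall q, W q -> 0 < u q.
Hypothesis v0 : forall q, W q -> 0 < c - 2 * u q.
Hypothesis du_neq0 : forall q, W q ->
  w ord0 q * w ord0 q + w ord_max q * w ord_max q != 0.
Hypothesis H_normal : forall q a, W q -> dot (H q) (dvec y a q) = 0.
Hypothesis H_trace : forall q, W q -> exists t0 t1 : R,
  g ord_max ord_max q *: dvec (dvec y ord0) ord0 q
  - (2 * g ord0 ord_max q) *: dvec (dvec y ord_max) ord0 q
  + g ord0 ord0 q *: dvec (dvec y ord_max) ord_max q =
  (2 * det q) *: H q + (t0 *: dvec y ord0 q + t1 *: dvec y ord_max q).
Hypothesis dH : forall q j, W q ->
  dvec H j q = - (c / 2) *: dvec y j q + w j q *: F q.
Hypothesis HF : forall q, W q -> dot (H q) (F q) = 2^-1.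
Hypothesis FF : forall q, W q -> 8 * u q ^+ 2 * dot (F q) (F q) = c.
Hypothesis Fy : forall q a, W q -> dot (F q) (dvec y a q) = w a q / (8 * u q ^+ 2).

Let A q := g ord_max ord_max q * w ord0 q - g ord0 ord_max q * w ord_max q.
Let B q := g ord0 ord0 q * w ord_max q - g ord0 ord_max q * w ord0 q.
(** The vector grad u, solved from the formula for F. In this form its derivative only involves F1,
    F, H and dy. *)
Let tau q : 'rV[R]_m := (8 * (u q * u q)) *: F q + (- 4 * u q) *: H q.

Hypothesis tauE : forall q, W q ->
  det q *: tau q = A q *: dvec y ord0 q + B q *: dvec y ord_max q.
Hypothesis normE : forall q, W q ->
  A q * w ord0 q + B q * w ord_max q = 8 * u q ^+ 2 * det q * (c - 2 * u q).

Let Su : smooth_on W u := normsq_smooth oW SH.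

Let un q : W q -> u q != 0.
Proof. by move=> Wq; rewrite gt_eqF // u0. Qed.

Let detn q : W q -> det q != 0.
Proof. by move=> Wq; rewrite gt_eqF // det0. Qed.

Let vn q : W q -> c - 2 * u q != 0.
Proof. by move=> Wq; rewrite gt_eqF // v0. Qed.

Lemma dot_tau_tangent q a : W q -> dot (tau q) (dvec y a q) = w a q.
Proof.
move=> Wq; rewrite /tau dotDl (dotZl _ (F q)) (dotZl _ (H q)) Fy // H_normal //.
by field; exact: un.
Qed.

Lemma dot_H_tau q : W q -> dot (H q) (tau q) = 0.
Proof.
move=> Wq; rewrite /tau dotDr (dotZr _ (F q)) (dotZr _ (H q)) HF // -/(normsq H q).
by field.
Qed.

Section chain.
Variable F1 : 'rV[R]_2 -> 'rV[R]_m.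
Hypotheses (SF1 : smooth_on W F1)
           (dF : forall q j, W q -> dvec F j q = w j q *: F1 q).

(** Each partial derivative of the constant u^2 F.F is w_j times one expression, which vanishes
    because du does not. *)
Lemma dot_F_F1 q : W q -> 8 * u q ^+ 3 * dot (F q) (F1 q) = - c.
Proof.
move=> Wq; have K p : W p -> u p * u p * dot (F p) (F p) = c / 8.
  by move=> Wp; rewrite -(FF Wp); field.
have D j := derive_cst_on oW Wq K (is_derive_mul
  (is_derive_mul (dscal_derive j Su Wq) (dscal_derive j Su Wq))
  (is_derive_dot (dvec_derive j SF Wq) (dvec_derive j SF Wq))).
have Z : 2 * u q * dot (F q) (F q) + 2 * u q ^+ 2 * dot (F q) (F1 q) = 0.
  apply: (@du_cancel _ _ _ du_neq0 q R^o) => // j.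
  rewrite -[RHS](D j) dF // (dotZl _ (F1 q)) (dotZr _ (F1 q)) (dotC (F1 q)).
  by rewrite -[LHS]/(w j q * _); ring.
have E := FF Wq.
transitivity (4 * u q * (2 * u q * dot (F q) (F q) + 2 * u q ^+ 2 * dot (F q) (F1 q))
   - 8 * u q ^+ 2 * dot (F q) (F q)); first by ring.
by rewrite Z E; ring.
Qed.

Lemma dot_H_F1 q : W q -> 16 * u q ^+ 2 * dot (H q) (F1 q) = - c.
Proof.
move=> Wq.
have D j := derive_cst_on oW Wq HF
  (is_derive_dot (dvec_derive j SH Wq) (dvec_derive j SF Wq)).
have Z : - (c / 2) / (8 * u q ^+ 2) + dot (F q) (F q) + dot (H q) (F1 q) = 0.
  apply: (@du_cancel _ _ _ du_neq0 q R^o) => // j.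
  rewrite -[RHS](D j) dF // dH // dotDl (dotZl _ (dvec y j q)) (dotZl _ (F q)).
  rewrite (dotZr _ (F1 q)) (dotC (dvec y j q)) Fy // -[LHS]/(w j q * _).
  by field; exact: un.
have E := FF Wq.
transitivity (16 * u q ^+ 2 *
   (- (c / 2) / (8 * u q ^+ 2) + dot (F q) (F q) + dot (H q) (F1 q))
   + c - 2 * (8 * u q ^+ 2 * dot (F q) (F q))); first by field; exact: un.
by rewrite Z E; ring.
Qed.

(** The coordinate velocity of a level curve of u is proportional to (w_1, -w_0), so this says that
    G is orthogonal to it. *)
Definition level_normal (G : 'rV[R]_2 -> 'rV[R]_m) := forall q, W q ->
  dot (G q) (dvec y ord0 q) * w ord_max q = dot (G q) (dvec y ord_max q) * w ord0 q.

(** The tangential part of such a G is phi grad u; pairing with [tau] gives phi, as |grad u|^2 = 8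
    u^2 (c - 2u). *)
Lemma level_normal_factor G q : W q -> level_normal G ->
  exists2 phi : R, (forall a, dot (G q) (dvec y a q) = phi * w a q) &
    phi * (8 * u q ^+ 2 * (c - 2 * u q)) = dot (G q) (tau q).
Proof.
move=> Wq GN; have N0 := du_neq0 Wq.
pose phi := (dot (G q) (dvec y ord0 q) * w ord0 q + dot (G q) (dvec y ord_max q) * w ord_max q)
   / (w ord0 q * w ord0 q + w ord_max q * w ord_max q).
have Ea a : dot (G q) (dvec y a q) = phi * w a q.
  have E := GN q Wq; move: a; apply: ord2P; rewrite /phi mulrAC; apply: (mulIf N0); rewrite divfK //.
    transitivity (dot (G q) (dvec y ord0 q) * w ord0 q * w ord0 q
       + dot (G q) (dvec y ord0 q) * w ord_max q * w ord_max q); first by ring.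
    by rewrite E; ring.
  transitivity (dot (G q) (dvec y ord_max q) * w ord0 q * w ord0 q
     + dot (G q) (dvec y ord_max q) * w ord_max q * w ord_max q); first by ring.
  by rewrite -E; ring.
exists phi => //; apply: (mulfI (detn Wq)); rewrite -(dotZr (det q)) tauE // dotDr.
rewrite (dotZr _ (dvec y ord0 q)) (dotZr _ (dvec y ord_max q)) !Ea.
transitivity (phi * (8 * u q ^+ 2 * det q * (c - 2 * u q))); first by ring.
by rewrite -normE //; ring.
Qed.

Let Z q : 'rV[R]_m := (8 * u q ^+ 2) *: F1 q + (12 * u q) *: F q + (- 4) *: H q.

Lemma derive_tau q j : W q ->
  is_derive q (ebase R j) tau (w j q *: Z q + (2 * c * u q) *: dvec y j q).
Proof.
move=> Wq; have Du := dscal_derive j Su Wq.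
have D1 := is_derive_scale (is_derive_mul (is_derive_cst (8 : R) q (ebase R j))
  (is_derive_mul Du Du)) (dvec_derive j SF Wq).
have D2 := is_derive_scale (is_derive_mul (is_derive_cst (- 4 : R) q (ebase R j)) Du)
  (dvec_derive j SH Wq).
apply: is_derive_eq (is_derive_add D1 D2) _.
rewrite dF // dH //; apply/rowP => i; rewrite /Z !mxE /=.
by field.
Qed.

(* The level curves of u have second derivative orthogonal to G, F and F1; the
   trace of the second fundamental form computes this second derivative modulo
   tangent vectors. *)
Lemma trace_identity G G1 q : smooth_on W G ->
  (forall p j, W p -> dvec G j p = w j p *: G1 p) -> level_normal G -> W q ->
  2 * u q ^+ 2 * (c - 2 * u q) * dot (G q) (F1 q) + 2 * u q * c * dot (G q) (F q)
    - c * dot (G q) (H q) = 0.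
Proof.
move=> SG dG GN Wq; have [phi Ga Gt] := level_normal_factor Wq GN.
(* The normal part of G, since phi [tau] is its tangential part. *)
pose nu := G q - phi *: tau q.
have nuy a : dot (dvec y a q) nu = 0.
  by rewrite dotDr dotNr dotZr !(dotC (dvec y a q)) dot_tau_tangent // Ga subrr.
have nut : dot (tau q) nu = 0.
  apply: (mulfI (detn Wq)); rewrite -dotZl tauE // dotDl (dotZl _ (dvec y ord0 q)).
  by rewrite (dotZl _ (dvec y ord_max q)) !nuy !mulr0 addr0.
pose d i a := dvec (dvec y a) i q.
have dC : d ord_max ord0 = d ord0 ord_max by rewrite /d (dvecC ord0 ord_max oW Sy Wq).
pose ww i a := dscal (w a) i q.
have wC : ww ord_max ord0 = ww ord0 ord_max by rewrite /ww (dscalC ord0 ord_max oW Su Wq).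
(* The derivative of the relation [level_normal G], in which the products G.y_a are replaced by phi
   w_a. *)
have P j : (w j q * dot (G1 q) (dvec y ord0 q) + dot (G q) (d j ord0)) * w ord_max q
      + phi * w ord0 q * ww j ord_max =
    (w j q * dot (G1 q) (dvec y ord_max q) + dot (G q) (d j ord_max)) * w ord0 q
      + phi * w ord_max q * ww j ord0.
  have D a b := is_derive_mul
    (is_derive_dot (dvec_derive j SG Wq) (dvec_derive j (dvec_smooth a Sy) Wq))
    (dscal_derive j (dscal_smooth b Su) Wq).
  have := derive_eq_fun oW Wq GN (D ord0 ord_max) (D ord_max ord0).
  by rewrite !dG // !(dotZl _ (G1 q)) !Ga -!/(d _ _) -!/(ww _ _).
have T j a : dot (d j a) (tau q) =
    ww j a - (w j q * dot (Z q) (dvec y a q) + 2 * c * u q * g j a q).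
  have D := derive_eq_fun oW Wq (fun p Wp => dot_tau_tangent a Wp)
    (is_derive_dot (derive_tau j Wq) (dvec_derive j (dvec_smooth a Sy) Wq))
    (dscal_derive j (dscal_smooth a Su) Wq).
  rewrite /ww -D dotDl (dotZl _ (Z q)) (dotZl _ (dvec y j q)) -/(gram y j a q) -/(d j a).
  by rewrite (dotC (tau q)); ring.
have N j a : dot (d j a) nu = dot (G q) (d j a) -
    phi * (ww j a - (w j q * dot (Z q) (dvec y a q) + 2 * c * u q * g j a q)).
  by rewrite dotDr dotNr (dotZr _ (tau q)) T dotC.
have SA : smooth_on W A by exact: grad_coef_smooth.
have SB : smooth_on W B by exact: grad_coef_smooth.
(* Differentiating [tauE] and pairing with the normal vector nu removes every term with a tangent
   factor, among them the derivatives of A, B and the determinant. *)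
have X j : det q * (w j q * dot (Z q) nu) =
    A q * dot (d j ord0) nu + B q * dot (d j ord_max) nu.
  have D := derive_eq_fun oW Wq tauE
    (is_derive_scale (dscal_derive j (gdet_smooth oW Sy) Wq) (derive_tau j Wq))
    (is_derive_add
      (is_derive_scale (dscal_derive j SA Wq) (dvec_derive j (dvec_smooth ord0 Sy) Wq))
      (is_derive_scale (dscal_derive j SB Wq) (dvec_derive j (dvec_smooth ord_max Sy) Wq))).
  exact: (dot_normal_combination D nut (nuy j) (nuy ord0) (nuy ord_max)).
have tr : g ord_max ord_max q * dot (d ord0 ord0) nu
    - 2 * g ord0 ord_max q * dot (d ord0 ord_max) nu
    + g ord0 ord0 q * dot (d ord_max ord_max) nu = 2 * det q * dot (G q) (H q).
  have [t0 [t1 /(congr1 (fun v => dot v nu))]] := H_trace Wq.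
  rewrite !dotDl dotNl !(dotZl _ (dvec (dvec y _) _ q)) !(dotZl _ (dvec y _ q)) !nuy.
  rewrite !mulr0 !addr0 (dotZl _ (H q)) => ->; congr (_ * _).
  by rewrite dotDr dotNr (dotZr _ (tau q)) dot_H_tau // mulr0 subr0 dotC.
have Wn : A q * w ord0 q + B q * w ord_max q != 0.
  by rewrite normE // !mulf_neq0 ?pnatr_eq0 ?expf_neq0 ?un ?detn ?vn.
have E := trace_identity_algebra (detn Wq) Wn (P ord0) _ (N ord0 ord0)
  (N ord0 ord_max) _ (N ord_max ord_max) (X ord0) _ tr.
have {}E : 2 * dot (G q) (H q) = dot (Z q) nu + 2 * c * u q * phi.
  apply: E.
  - by have := P ord_max; rewrite dC wC.
  - by have := N ord_max ord0; rewrite dC wC (gramC y ord_max ord0).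
  - by have := X ord_max; rewrite dC.
have Zt : dot (Z q) (tau q) = 6 * c * u q - 24 * u q ^+ 2.
  rewrite /Z !dotDl (dotZl _ (F1 q)) (dotZl _ (F q)) (dotZl _ (H q)) dot_H_tau //.
  rewrite /tau !dotDr !(dotZr _ (F q)) !(dotZr _ (H q)) (dotC (F1 q)) (dotC (F1 q)).
  rewrite (dotC (F q) (H q)) HF //.
  have e1 := dot_F_F1 Wq; have e2 := dot_H_F1 Wq; have e3 := FF Wq.
  transitivity (8 * u q * (8 * u q ^+ 3 * dot (F q) (F1 q))
    - 2 * u q * (16 * u q ^+ 2 * dot (H q) (F1 q))
    + 12 * u q * (8 * u q ^+ 2 * dot (F q) (F q)) - 24 * u q ^+ 2); first by field.
  by rewrite e1 e2 e3; field.
have ZG : dot (Z q) nu = 8 * u q ^+ 2 * dot (G q) (F1 q) + 12 * u q * dot (G q) (F q)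
    - 4 * dot (G q) (H q) - phi * (6 * c * u q - 24 * u q ^+ 2).
  rewrite dotDr dotNr (dotZr _ (tau q)) Zt /Z !dotDl (dotZl _ (F1 q)) (dotZl _ (F q)).
  by rewrite (dotZl _ (H q)) !(dotC _ (G q)); ring.
have GT : dot (G q) (tau q) = 8 * u q ^+ 2 * dot (G q) (F q) - 4 * u q * dot (G q) (H q).
  by rewrite /tau dotDr (dotZr _ (F q)) (dotZr _ (H q)); ring.
rewrite GT in Gt; rewrite ZG in E.
have phE : phi = (8 * u q ^+ 2 * dot (G q) (F q) - 4 * u q * dot (G q) (H q)) /
    (8 * u q ^+ 2 * (c - 2 * u q)).
  by rewrite -Gt mulfK // !mulf_neq0 ?pnatr_eq0 ?expf_neq0 ?un ?vn.
(* The factor (c - 2u)/4 cancels the denominator of phi and normalises the coefficient of G.F1. *)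
transitivity ((c - 2 * u q) / 4 * (8 * u q ^+ 2 * dot (G q) (F1 q)
   + 12 * u q * dot (G q) (F q) - 4 * dot (G q) (H q) - phi * (6 * c * u q - 24 * u q ^+ 2)
   + 2 * c * u q * phi - 2 * dot (G q) (H q))).
  by rewrite phE; field; rewrite un ?vn.
by rewrite E; ring.
Qed.

(* Differentiate [k (G . y_i) = a w_i] and use the symmetry of the second
   derivatives of y and u. *)
Lemma level_normal_next (G G1 : 'rV[R]_2 -> 'rV[R]_m) (k k1 : 'rV[R]_2 -> R) (a : R) :
  smooth_on W G -> (forall p j, W p -> dvec G j p = w j p *: G1 p) ->
  (forall p j, W p -> is_derive p (ebase R j) k (w j p * k1 p)) ->
  (forall p, W p -> k p != 0) ->
  (forall p i, W p -> k p * dot (G p) (dvec y i p) = w i p * a) -> level_normal G1.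
Proof.
move=> SG dG dk k0 GN q Wq.
have D i j := derive_eq_fun oW Wq (fun p Wp => GN p i Wp)
  (is_derive_mul (dk q j Wq)
     (is_derive_dot (dvec_derive j SG Wq) (dvec_derive j (dvec_smooth i Sy) Wq)))
  (is_derive_mul (dscal_derive j (dscal_smooth i Su) Wq) (is_derive_cst a q (ebase R j))).
have E i : dot (G q) (dvec y i q) = w i q * a / k q.
  by rewrite -GN // mulrC mulKf // k0.
have E1 := D ord0 ord_max; have E2 := D ord_max ord0.
rewrite (dvecC ord0 ord_max oW Sy Wq) (dscalC ord0 ord_max oW Su Wq) !mulr0 !addr0 in E1 E2.
have := etrans E1 (esym E2); rewrite !dG // !(dotZl _ (G1 q)) !E => {E1 E2} E12.
apply: (mulfI (k0 q Wq)); apply/eqP; rewrite -subr_eq0; apply/eqP.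
move/eqP: E12; rewrite -subr_eq0 => /eqP <-.
by ring.
Qed.

End chain.

Lemma gradient_absurd q : W q -> False.
Proof.
move=> Wq.
have [F1 SF1 dF] : exists2 F1, smooth_on W F1 &
    forall q i, W q -> dvec F i q = w i q *: F1 q.
  (* The chain starts at H + (c/2) y, whose differential is exactly du F by [dH]. *)
  pose G q := H q + (c / 2) *: y q.
  have SG : smooth_on W G.
    by apply: smoothD => //; apply: smoothZ => //; exact: smooth_cst.
  apply: (next_derivative oW Su du_neq0 SG SF) => p j Wp.
  apply: dvec_val; have := is_derive_add (dvec_derive j SH Wp)
    (is_derive_scale (is_derive_cst (c / 2) p (ebase R j)) (dvec_derive j Sy Wp)).
  move=> D; apply: is_derive_eq D _; rewrite dH //.
  by apply/rowP => k; rewrite !mxE /=; ring.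
have [F2 SF2 dF1] := next_derivative oW Su du_neq0 SF SF1 dF.
have [F3 SF3 dF2] := next_derivative oW Su du_neq0 SF1 SF2 dF1.
have Du p j : W p -> is_derive p (ebase R j) u (w j p) by exact: dscal_derive.
have N1 : level_normal F1.
  (* The relation is [Fy] with its denominator cleared: u^2 F.y_i = w_i/8. *)
  apply: (@level_normal_next F F1 (fun p => u p * u p) (fun p => 2 * u p) 8^-1) => //.
  - move=> p j Wp; apply: is_derive_eq (is_derive_mul (Du p j Wp) (Du p j Wp)) _; ring.
  - by move=> p Wp; rewrite mulf_neq0 // un.
  - by move=> p i Wp; rewrite Fy //; field; exact: un.
(* The value -3c is 4u F1.tau, computed from F.F1 and H.F1. With k = 32 u^3 (c - 2u) this is the
   relation that [level_normal_next] needs to pass to F2. *)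
have phi1 p i : W p ->
    (32 * u p ^+ 3 * (c - 2 * u p)) * dot (F1 p) (dvec y i p) = w i p * (- 3 * c).
  move=> Wp; have [phi -> E] := level_normal_factor Wp N1.
  have e1 := dot_F_F1 dF Wp; have e2 := dot_H_F1 dF Wp.
  have T : 4 * u p * dot (F1 p) (tau p) = - 3 * c.
    rewrite /tau dotDr (dotZr _ (F p)) (dotZr _ (H p)) !(dotC (F1 p)).
    transitivity (4 * (8 * u p ^+ 3 * dot (F p) (F1 p)) - 16 * u p ^+ 2 * dot (H p) (F1 p)).
      by ring.
    by rewrite e1 e2; ring.
  by rewrite -T -E; ring.
have N2 : level_normal F2.
  apply: (@level_normal_next F1 F2 (fun p => 32 * (u p * (u p * u p)) * (c + (- 2) * u p))
    (fun p => 96 * u p ^+ 2 * (c - 2 * u p) - 64 * u p ^+ 3) (- 3 * c)) => //.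
  - move=> p j Wp.
    have D0 k := is_derive_cst (k : R) p (ebase R j).
    have D := Du p j Wp.
    have := is_derive_mul (is_derive_mul (D0 32) (is_derive_mul D (is_derive_mul D D)))
      (is_derive_add (D0 c) (is_derive_mul (D0 (- 2)) D)).
    by move=> D'; apply: is_derive_eq D' _ => /=; ring.
  - move=> p Wp; have -> : c + - 2 * u p = c - 2 * u p by ring.
    by rewrite !mulf_neq0 ?pnatr_eq0 ?un ?vn.
  - by move=> p i Wp; rewrite -phi1 //; ring.
(* The trace identity with G = F1, where F1.F and F1.H are already known. *)
have K1 p : W p -> 32 * u p ^+ 4 * (c - 2 * u p) * dot (F1 p) (F1 p) = 3 * c ^+ 2.
  move=> Wp; have TI := trace_identity dF SF1 dF1 N1 Wp.
  have e1 := dot_F_F1 dF Wp; have e2 := dot_H_F1 dF Wp.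
  rewrite (dotC (F1 p) (F p)) (dotC (F1 p) (H p)) in TI.
  transitivity (16 * u p ^+ 2 * (2 * u p ^+ 2 * (c - 2 * u p) * dot (F1 p) (F1 p)
     + 2 * u p * c * dot (F p) (F1 p) - c * dot (H p) (F1 p))
     - 4 * c * (8 * u p ^+ 3 * dot (F p) (F1 p))
     + c * (16 * u p ^+ 2 * dot (H p) (F1 p))); first by ring.
  by rewrite TI e1 e2; ring.
have [phi ph _] := level_normal_factor Wq N1.
have cancel (z : R) : (forall j, w j q * z = 0) -> z = 0.
  by move=> Hz; exact: (@du_cancel _ _ _ du_neq0 q R^o z Wq Hz).
have DU j := dscal_derive j Su Wq.
have DF1 j := dvec_derive j SF1 Wq.
have D0 j (k : R) := is_derive_cst k q (ebase R j).
(* [S6], [S7], [S8] are the derivatives of the formulas for F1.F1, F.F1 and H.F1, with the factor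
   w_j cancelled; they determine the products of F2 with F1, F and H. *)
have S6 : (4 * u q ^+ 3 * (c - 2 * u q) - 2 * u q ^+ 4) * dot (F1 q) (F1 q)
    + 2 * u q ^+ 4 * (c - 2 * u q) * dot (F1 q) (F2 q) = 0.
  have K p : W p -> (u p * u p) * (u p * u p) * (c + (- 2) * u p) * dot (F1 p) (F1 p)
      = 3 * c ^+ 2 / 32 by move=> Wp; rewrite -(K1 p Wp); field.
  have D j := derive_cst_on oW Wq K (is_derive_mul (is_derive_mul
    (is_derive_mul (is_derive_mul (DU j) (DU j)) (is_derive_mul (DU j) (DU j)))
    (is_derive_add (D0 j c) (is_derive_mul (D0 j (- 2)) (DU j))))
    (is_derive_dot (DF1 j) (DF1 j))).
  apply: cancel => j; rewrite -[RHS](D j) dF1 // (dotZl _ (F2 q)) (dotZr _ (F2 q)).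
  by rewrite (dotC (F2 q)) /=; ring.
have S7 : 3 * u q ^+ 2 * dot (F q) (F1 q)
    + u q ^+ 3 * (dot (F1 q) (F1 q) + dot (F q) (F2 q)) = 0.
  have K p : W p -> u p * (u p * u p) * dot (F p) (F1 p) = - c / 8.
    by move=> Wp; rewrite -(dot_F_F1 dF Wp); field.
  have D j := derive_cst_on oW Wq K (is_derive_mul
    (is_derive_mul (DU j) (is_derive_mul (DU j) (DU j)))
    (is_derive_dot (dvec_derive j SF Wq) (DF1 j))).
  apply: cancel => j; rewrite -[RHS](D j) dF1 // dF // (dotZl _ (F1 q)) (dotZr _ (F2 q)).
  by ring.
have S8 : 2 * u q * dot (H q) (F1 q)
    + u q ^+ 2 * (- (c / 2) * phi + dot (F q) (F1 q) + dot (H q) (F2 q)) = 0.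
  have K p : W p -> u p * u p * dot (H p) (F1 p) = - c / 16.
    by move=> Wp; rewrite -(dot_H_F1 dF Wp); field.
  have D j := derive_cst_on oW Wq K (is_derive_mul (is_derive_mul (DU j) (DU j))
    (is_derive_dot (dvec_derive j SH Wq) (DF1 j))).
  apply: cancel => j; rewrite -[RHS](D j) dF1 // dH // dotDl (dotZl _ (dvec y j q)).
  rewrite (dotZl _ (F q)) (dotZr _ (F2 q)) (dotC (dvec y j q)) ph.
  by ring.
(* The overdetermining relation: the products of F2 with F1, F and H that occur here are already
   fixed by [S6], [S7] and [S8]. *)
have TI := trace_identity dF SF2 dF2 N2 Wq.
apply: (@final_contradiction R c (u q) (dot (F1 q) (F1 q)) (dot (F1 q) (F2 q))
  (dot (F q) (F1 q)) (dot (F q) (F2 q)) (dot (H q) (F2 q)) (dot (H q) (F1 q)) phi) => //.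
- exact: u0.
- exact: v0.
- exact: K1.
- exact: dot_F_F1.
- exact: dot_H_F1.
- have cz (z : R) : (forall j, w j q * z = 0) -> z = 0 by exact: cancel.
  apply/eqP; rewrite -subr_eq0; apply/eqP; apply: cz => j.
  by have := phi1 q j Wq; rewrite ph => E; rewrite mulrBr -E; ring.
- by rewrite -[RHS]TI !(dotC (F2 q)).
Qed.

End nonconstant_mean_curvature.

(** * Vanishing of du and umbilicity in the direction of H *)

Section constant_mean_curvature.
Context {R : realType} {m : nat}.
Variables (U : set 'rV[R]_2) (y H : 'rV[R]_2 -> 'rV[R]_m) (c : R).

Local Notation g := (gram y).
Local Notation det := (gdet y).
Local Notation u := (normsq H).
Local Notation w := (dscal (normsq H)).

Hypotheses (oU : open U) (Sy : smooth_on U y) (SH : smooth_on U H) (c0 : 0 < c).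
Hypothesis det0 : forall q, U q -> 0 < det q.
Hypothesis H0 : forall q, U q -> H q != 0.
Hypothesis H_normal : forall q a, U q -> dot (H q) (dvec y a q) = 0.
Hypothesis H_trace : forall q, U q -> exists t0 t1 : R,
  g ord_max ord_max q *: dvec (dvec y ord0) ord0 q
  - (2 * g ord0 ord_max q) *: dvec (dvec y ord_max) ord0 q
  + g ord0 ord0 q *: dvec (dvec y ord_max) ord_max q =
  (2 * det q) *: H q + (t0 *: dvec y ord0 q + t1 *: dvec y ord_max q).
Hypothesis H_parallel : forall q j, U q -> exists s t0 t1 : R,
  dvec H j q = s *: H q + (t0 *: dvec y ord0 q + t1 *: dvec y ord_max q).
Hypothesis H_homothetic : forall q i j, U q ->
  dot (dvec H i q) (dvec H j q) = c ^+ 2 / 4 * g i j q.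

Let normE q : U q ->
  (g ord_max ord_max q * w ord0 q - g ord0 ord_max q * w ord_max q) * w ord0 q
  + (g ord0 ord0 q * w ord_max q - g ord0 ord_max q * w ord0 q) * w ord_max q =
  8 * u q ^+ 2 * det q * (c - 2 * u q).
Proof.
move=> Uq.
have [_ <-] := shape_operatorE oU Sy SH c0 det0 H0 H_normal H_trace H_parallel H_homothetic Uq.
ring.
Qed.

Let N q := w ord0 q * w ord0 q + w ord_max q * w ord_max q.

Lemma gradient_neq0_open : open (U `&` [set q | N q != 0]).
Proof.
have Sw a := dscal_smooth a (normsq_smooth oU SH).
have SN : smooth_on U N by apply: smoothD => //; apply: smoothM => //; exact: Sw.
rewrite openE => q [Uq Nq].
have nU : nbhs q U by exact: open_nbhs_nbhs.
have nN : nbhs q (N @^-1` [set z | z != 0]).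
  apply: (smooth_cont SN Uq); apply: open_nbhs_nbhs; split; last exact: Nq.
  exact: (@open_neq R 0).
exact: (@filterI _ _ (nbhs_filter q) _ _ nU nN).
Qed.

(** By [normE], c - 2u is a positive multiple of the squared length of grad u. *)
Lemma speed_gap_gt0 q : U q -> N q != 0 -> 0 < c - 2 * u q.
Proof.
move=> Uq Nq; have d0 := det0 Uq; have g0 := gram00_gt0 det0 Uq; have uq := normsq_gt0 H0 Uq.
have : 0 < g ord0 ord0 q * (8 * u q ^+ 2 * det q * (c - 2 * u q)).
  rewrite -normE //.
  set w0 := w ord0 q in Nq *; set w1 := w ord_max q in Nq *.
  (* Completing the square exhibits the form as positive definite in (w0, w1). *)
  have -> : forall a b d : R, a * ((d * w0 - b * w1) * w0 + (a * w1 - b * w0) * w1) =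
    (a * w1 - b * w0) ^+ 2 + (a * d - b * b) * w0 ^+ 2 by move=> a b d; ring.
  rewrite -/(gdet y q).
  have [w00|w00] := eqVneq w0 0.
    have w1n : w1 != 0.
      by apply: contraNneq Nq => w10; rewrite /N -/w0 -/w1 w00 w10 mulr0 addr0.
    rewrite w00 mulr0 subr0 expr0n /= mulr0 addr0 exprn_even_gt0 //=.
    by rewrite (mulf_neq0 _ w1n) // gt_eqF.
  by rewrite ltr_wpDl ?sqr_ge0 // mulr_gt0 // exprn_even_gt0.
by rewrite pmulr_rgt0 // pmulr_rgt0 // !mulr_gt0 // exprn_gt0.
Qed.

Lemma gradient_eq0 q j : U q -> w j q = 0.
Proof.
move=> Uq; apply: contrapT => wj.
pose W := U `&` [set q | N q != 0].
have WU : W `<=` U by move=> p [].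
have Wq : W q.
  split=> //=; apply: contra_notN wj; rewrite /N paddr_eq0 -?expr2 ?sqr_ge0 //.
  rewrite !sqrf_eq0 => /andP[/eqP w0 /eqP w1].
  by move: j; exact: (ord2P w0 w1).
have SH1 := rate_smooth oU Sy SH det0 H0.
apply: (@gradient_absurd R m W y H (rate y H) c gradient_neq0_open
  (smooth_sub WU Sy) (smooth_sub WU SH) (smooth_sub WU SH1) c0) Wq.
- by move=> p /WU; exact: det0.
- by move=> p /WU Up; exact: (normsq_gt0 H0 Up).
- by move=> p [Up Np]; exact: speed_gap_gt0.
- by move=> p [_].
- by move=> p a /WU; exact: H_normal.
- by move=> p /WU; exact: H_trace.
- move=> p i /WU Up.
  exact: (dvec_mean_curvature oU Sy SH c0 det0 H0 H_normal H_trace H_parallel H_homothetic).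
- by move=> p /WU Up; exact: (dot_normal_rate H0 H_normal Up).
- move=> p /WU Up.
  exact: (dot_rate_rate oU Sy SH c0 det0 H0 H_normal H_trace H_parallel H_homothetic).
- by move=> p a /WU Up; exact: (dot_rate_tangent det0 H_normal a Up).
- move=> p /WU Up; have un : u p != 0 by rewrite gt_eqF // (normsq_gt0 H0 Up).
  have dn : det p != 0 by rewrite gt_eqF // det0.
  have -> : (8 * (u p * u p)) *: rate y H p + (- 4 * u p) *: H p = grad_vector y H p.
    rewrite /rate; move: (grad_vector y H p) => G; apply/rowP => i; rewrite !mxE.
    by field; exact: un.
  by rewrite /grad_vector scalerA mulfV // scale1r.
- by move=> p /WU Up; exact: normE.
Qed.

(** With du = 0 the norm identity reduces to c = 2u, which turns the coefficient -c/2 of dy into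
    -u. *)
Lemma umbilic q j : U q -> dvec H j q = - u q *: dvec y j q.
Proof.
move=> Uq; have uq := normsq_gt0 H0 Uq; have d0 := det0 Uq.
have E := dvec_mean_curvature oU Sy SH c0 det0 H0 H_normal H_trace H_parallel H_homothetic j Uq.
rewrite E gradient_eq0 // scale0r addr0; congr (- _ *: _).
have := normE Uq; rewrite !gradient_eq0 // !mulr0 addr0 => /esym/eqP.
rewrite mulf_eq0 subr_eq0 gt_eqF ?mulr_gt0 ?exprn_gt0 //= => /eqP ->.
by field.
Qed.

End constant_mean_curvature.

(** * Surfaces in charts *)

Lemma sum_ord2 (V : nmodType) (F : 'I_2 -> V) : \sum_(i < 2) F i = F ord0 + F ord_max.
Proof. by rewrite big_ord_recl big_ord1; congr (_ + F _); exact: val_inj. Qed.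

(** The passage from the definition of H to [H_trace], stated over plain scalars and vectors so that
    [field] meets no derivative. *)
Lemma trace_clear_denominators (R : realType) m (G : 'I_2 -> 'I_2 -> R)
    (h P : 'I_2 -> 'I_2 -> 'rV[R]_m) (e0 e1 v : 'rV[R]_m) (g00 g01 g11 d : R) :
  d != 0 ->
  G ord0 ord0 = g11 / d -> G ord0 ord_max = - g01 / d ->
  G ord_max ord0 = - g01 / d -> G ord_max ord_max = g00 / d ->
  (forall j k, exists t0 t1 : R, P j k = h j k - (t0 *: e0 + t1 *: e1)) ->
  h ord_max ord0 = h ord0 ord_max ->
  v = 2^-1 *: \sum_j \sum_k G j k *: P j k ->
  exists t0 t1 : R,
    g11 *: h ord0 ord0 - (2 * g01) *: h ord0 ord_max + g00 *: h ord_max ord_max =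
    (2 * d) *: v + (t0 *: e0 + t1 *: e1).
Proof.
move=> dn G00 G01 G10 G11 PE hC ->; rewrite !sum_ord2 G00 G01 G10 G11.
have [a0 [a1 ->]] := PE ord0 ord0; have [b0 [b1 ->]] := PE ord0 ord_max.
have [c0 [c1 ->]] := PE ord_max ord0; have [d0 [d1 ->]] := PE ord_max ord_max.
rewrite hC.
exists (g11 * a0 - g01 * b0 - g01 * c0 + g00 * d0),
       (g11 * a1 - g01 * b1 - g01 * c1 + g00 * d1).
by apply/rowP => i; rewrite !mxE; field.
Qed.

Section surface_chart.
Context {R : realType} {m : nat} {M : smooth_manifold R 2}.
Variables (g : riemannian_metric M) (x : M -> 'rV[R]_m).
Hypothesis hx : isometric_immersion g x.
Variable c : chart R 2 M.
Hypothesis Mc : atlas M c.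

Local Notation U := (cimg c).
Local Notation y := (x \o cinv c).
Local Notation H := (mean_curvature g x \o cinv c).

Lemma gram_gmat a b q : U q -> gram y a b q = gmat g c q a b.
Proof. by move=> Uq; rewrite (gmat_dot hx a b Mc Uq) /gram !dvecE. Qed.

Lemma gdet_gt0 q : U q -> 0 < gdet y q.
Proof.
move=> Uq; pose a := gram y ord0 ord0 q; pose b := gram y ord0 ord_max q.
have e0n : ebase R ord0 != 0 :> 'rV[R]_2.
  by apply/eqP => /rowP /(_ ord0); rewrite !mxE !eqxx => /eqP; rewrite oner_eq0.
have a0 : 0 < a.
  have := gmat_pos g Mc Uq e0n.
  by rewrite ebase_form -(gram_gmat ord0 ord0 Uq).
(* The Gram-Schmidt vector of the second basis vector, scaled by a; the metric form takes the value
   a times the determinant on it. *)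
pose v : 'rV[R]_2 := a *: ebase R ord_max - b *: ebase R ord0.
have vn : v != 0.
  apply/eqP => /rowP /(_ ord_max); rewrite !mxE !eqxx /= mulr1 mulr0 subr0 => /eqP.
  by rewrite gt_eqF.
have := gmat_pos g Mc Uq vn.
have -> : (v *m gmat g c q *m v^T) 0 0 = a * gdet y q.
  rewrite mxE sum_ord2 ![(v *m _) _ _]mxE !sum_ord2 /v !mxE !eqxx /= -!gram_gmat //.
  by rewrite /gdet (gramC y ord_max ord0) /a /b; ring.
by rewrite pmulr_rgt0.
Qed.

Lemma ginv_entries q : U q ->
  [/\ ginv g c q ord0 ord0 = gram y ord_max ord_max q / gdet y q,
      ginv g c q ord0 ord_max = - gram y ord0 ord_max q / gdet y q,
      ginv g c q ord_max ord0 = - gram y ord0 ord_max q / gdet y q &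
      ginv g c q ord_max ord_max = gram y ord0 ord0 q / gdet y q].
Proof.
move=> Uq; have dn : gdet y q != 0 by rewrite gt_eqF // gdet_gt0.
have E a b : ginv g c q a ord0 * gram y ord0 b q + ginv g c q a ord_max * gram y ord_max b q =
    (a == b)%:R.
  have := congr1 (fun A : 'M[R]_2 => A a b) (mulVmx (gmat_unit g Mc Uq)).
  by rewrite !mxE sum_ord2 !gram_gmat.
have S a : (ginv g c q a ord0 = ((a == ord0)%:R * gram y ord_max ord_max q
      - (a == ord_max)%:R * gram y ord0 ord_max q) / gdet y q) /\
    (ginv g c q a ord_max = ((a == ord_max)%:R * gram y ord0 ord0 q
      - (a == ord0)%:R * gram y ord0 ord_max q) / gdet y q).
  split; apply: (canRL (mulfK dn)); rewrite -!E (gramC y ord_max ord0) /gdet; ring.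
have [S00 S01] := S ord0; have [S10 S11] := S ord_max.
by split; rewrite ?S00 ?S01 ?S10 ?S11 /= ?eqxx /= ?mul1r ?mul0r ?subr0 ?sub0r.
Qed.

Lemma ginv_smooth a b : smooth_on U (fun q => ginv g c q a b).
Proof.
have oU := open_cimg c; have Sy : smooth_on U y := chart_smooth hx Mc.
have Sg i j : smooth_on U (gram y i j) by exact: (gram_smooth oU Sy i j).
have Sd : smooth_on U (fun q => (gdet y q)^-1).
  apply: smoothV => //; last exact: (gdet_smooth oU Sy).
  by move=> q /gdet_gt0 d0; rewrite gt_eqF.
have Sn : smooth_on U (fun q => - gram y ord0 ord_max q / gdet y q).
  apply: (@smooth_eq _ _ _ _ (fun q => -1 * gram y ord0 ord_max q * (gdet y q)^-1)) => //.
    by move=> q _; rewrite mulN1r.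
  by do 2!apply: smoothM => //; exact: smooth_cst.
move: a b; apply: ord2P; apply: ord2P.
- apply: (smooth_eq oU _ (smoothM oU (Sg ord_max ord_max) Sd)) => q Uq.
  by have [->] := ginv_entries Uq.
- by apply: (smooth_eq oU _ Sn) => q Uq; have [_ ->] := ginv_entries Uq.
- by apply: (smooth_eq oU _ Sn) => q Uq; have [_ _ ->] := ginv_entries Uq.
- apply: (smooth_eq oU _ (smoothM oU (Sg ord0 ord0) Sd)) => q Uq.
  by have [_ _ _ ->] := ginv_entries Uq.
Qed.

Lemma nproj_sub q v : U q -> exists t0 t1 : R,
  v *m nproj g x c q = v - (t0 *: dvec y ord0 q + t1 *: dvec y ord_max q).
Proof.
move=> Uq; have [cq E] := cinvK Uq.
have := normal_partE g x v Mc cq; rewrite E => <-.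
rewrite /normal_part sum_ord2 -!scaler_suml E !dmap_ebase E -!dvecE.
by eexists; eexists.
Qed.

Lemma mean_curvature_chartE q : U q ->
  H q = 2^-1 *: \sum_j \sum_k ginv g c q j k *: (hessian_vector x c q j k *m nproj g x c q).
Proof.
move=> Uq; have [cq E] := cinvK Uq.
rewrite /= (mean_curvature_chart hx Mc cq) /trace_form E; congr (_ *: _).
apply: eq_bigr => j _; apply: eq_bigr => k _.
by rewrite (second_fundamental_formE g x j k Mc cq) E.
Qed.

Lemma mean_curvature_smooth : smooth_on U H.
Proof.
have oU := open_cimg c; have Sy := chart_smooth hx Mc.
pose F q : 'rV[R]_m := 2^-1 *: \sum_j \sum_k ginv g c q j k *:
  (dvec (dvec y k) j q - \sum_a \sum_b
    (ginv g c q a b * dot (dvec (dvec y k) j q) (dvec y b q)) *: dvec y a q).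
apply: (@smooth_eq _ _ _ _ F) => //.
  move=> q Uq; rewrite mean_curvature_chartE // /F; congr (_ *: _).
  apply: eq_bigr => j _; apply: eq_bigr => k _; congr (_ *: _).
  have [cq E] := cinvK Uq.
  have := normal_partE g x (hessian_vector x c q j k) Mc cq; rewrite E => <-.
  rewrite /normal_part /hessian_vector E !dvecE; congr (_ - _).
  by apply: eq_bigr => a _; apply: eq_bigr => b _; rewrite !dmap_ebase E !dvecE.
have Sh j k : smooth_on U (dvec (dvec y k) j) by do 2!apply: dvec_smooth.
apply: smoothZ => //; first exact: smooth_cst.
apply: smooth_sum => // j; apply: smooth_sum => // k.
apply: smoothZ => //; first exact: ginv_smooth.
apply: (@smooth_eq _ _ _ _ (fun q => dvec (dvec y k) j q + -1 *: \sum_a \sum_b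
    (ginv g c q a b * dot (dvec (dvec y k) j q) (dvec y b q)) *: dvec y a q)) => //.
  by move=> q _; rewrite scaleN1r.
apply: smoothD => //; apply: smoothZ => //; first exact: smooth_cst.
apply: smooth_sum => // a; apply: smooth_sum => // b.
apply: smoothZ => //; last exact: dvec_smooth.
apply: smoothM => //; first exact: ginv_smooth.
by apply: smooth_dot => //; exact: dvec_smooth.
Qed.

Lemma mean_curvature_dvec q a : U q -> dot (H q) (dvec y a q) = 0.
Proof.
move=> Uq; have [cq E] := cinvK Uq.
by have := mean_curvature_normal hx a Mc cq; rewrite E dvecE.
Qed.

Lemma mean_curvature_trace q : U q -> exists t0 t1 : R,
  gram y ord_max ord_max q *: dvec (dvec y ord0) ord0 q
  - (2 * gram y ord0 ord_max q) *: dvec (dvec y ord_max) ord0 q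
  + gram y ord0 ord0 q *: dvec (dvec y ord_max) ord_max q =
  (2 * gdet y q) *: H q + (t0 *: dvec y ord0 q + t1 *: dvec y ord_max q).
Proof.
move=> Uq; have dn : gdet y q != 0 by rewrite gt_eqF // gdet_gt0.
have Sy := chart_smooth hx Mc.
have [e00 e01 e10 e11] := ginv_entries Uq.
have hC : dvec (dvec y ord0) ord_max q = dvec (dvec y ord_max) ord0 q.
  exact: (dvecC ord_max ord0 (open_cimg c) Sy Uq).
apply: (@trace_clear_denominators R m (ginv g c q) (fun j k => dvec (dvec y k) j q)
  (fun j k => hessian_vector x c q j k *m nproj g x c q)
  (dvec y ord0 q) (dvec y ord_max q) (H q) _ _ _ _ dn e00 e01 e10 e11 _ hC
  (mean_curvature_chartE Uq)) => j k.
have [t0 [t1 E]] := nproj_sub (hessian_vector x c q j k) Uq.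
by exists t0, t1; rewrite E /hessian_vector !dvecE.
Qed.

End surface_chart.

Lemma solve_scaled (R : realType) m (a b : R) (h d t : 'rV[R]_m) :
  b != 0 -> a *: h + b *: (d - t) = 0 -> d = - (a / b) *: h + t.
Proof.
move=> b0 Z; apply/rowP => i; have := congr1 (fun v : 'rV[R]_m => v 0 i) Z.
rewrite !mxE => Zi; apply: (mulfI b0).
transitivity (a * h 0 i + b * (d 0 i - t 0 i) - a * h 0 i + b * t 0 i); first by ring.
by rewrite Zi; field.
Qed.

(** * The two curvature hypotheses read in a chart *)

Section parallel_homothetic.
Context {R : realType} {m : nat} {M : smooth_manifold R 2}.
Variables (g : riemannian_metric M) (x : M -> 'rV[R]_m).
Hypotheses (hx : isometric_immersion g x) (hH : parallel_normalized_mean_curvature g x).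
Variable c : chart R 2 M.
Hypothesis Mc : atlas M c.

Local Notation U := (cimg c).
Local Notation y := (x \o cinv c).
Local Notation H := (mean_curvature g x \o cinv c).

(** Write the unit field as r H with r = 1/|H|. The normal part of dr H + r dH vanishes and H is
    normal, so the normal part of dH is -(dr/r) H. *)
Lemma parallel_chart q j : U q -> exists s t0 t1 : R,
  dvec H j q = s *: H q + (t0 *: dvec y ord0 q + t1 *: dvec y ord_max q).
Proof.
move=> Uq; have [cq E] := cinvK Uq; have [Hn0 par] := hH.
have SH := mean_curvature_smooth hx Mc.
have u0 p : U p -> 0 < normsq H p by move=> _; exact: dot_gt0 (Hn0 _).
pose r p := (Num.sqrt (normsq H p))^-1.
have rn p : U p -> Num.sqrt (normsq H p) != 0.
  by move=> Up; rewrite gt_eqF // sqrtr_gt0 u0.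
have Sr : smooth_on U r.
  apply: smoothV => //; first exact: open_cimg.
  by apply: smooth_sqrt => //; [exact: open_cimg | exact: normsq_smooth (open_cimg c) SH].
have D : is_derive q (ebase R j) (unit_mean_curvature g x \o cinv c)
    (dscal r j q *: H q + r q *: dvec H j q).
  exact: (is_derive_scale (dscal_derive j Sr Uq) (dvec_derive j SH Uq)).
have := par c (cinv c q) (ebase R j) Mc cq.
rewrite /normal_connection (normal_partE g x _ Mc cq) E /dmap E.
have -> : 'D_(ebase R j) (unit_mean_curvature g x \o cinv c) q =
    dscal r j q *: H q + r q *: dvec H j q by have [_ ->] := D.
rewrite mulmxDl -(scalemxAl (dscal r j q) (H q)) -(scalemxAl (r q) (dvec H j q)).
have -> : H q *m nproj g x c q = H q.
  apply: nproj_normal => a; rewrite -dvecE; exact: mean_curvature_dvec.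
have [t0 [t1 ->]] := nproj_sub g x Mc (dvec H j q) Uq.
move=> Z; exists (- (dscal r j q / r q)), t0, t1.
have rq : r q != 0 by rewrite invr_eq0 rn.
exact: solve_scaled Z.
Qed.

Lemma laplace_mapE p : laplace_map g x p = - 2 *: mean_curvature g x p.
Proof. by rewrite (laplace_map_mean_curvature hx) // scaleNr. Qed.

Lemma homothetic_chart (k : R) :
  (forall p (u v : 'rV[R]_2), cdom c p ->
     dot (dmap (laplace_map g x) c p u) (dmap (laplace_map g x) c p v) =
     k ^+ 2 * metric_at g c p u v) ->
  forall q i j, U q -> dot (dvec H i q) (dvec H j q) = k ^+ 2 / 4 * gram y i j q.
Proof.
move=> hom q i j Uq; have [cq E] := cinvK Uq.
have SH := mean_curvature_smooth hx Mc.
have D a : dmap (laplace_map g x) c (cinv c q) (ebase R a) = - 2 *: dvec H a q.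
  rewrite /dmap E.
  have D : is_derive q (ebase R a) (laplace_map g x \o cinv c)
      (0 *: H q + - 2 *: dvec H a q).
    have -> : laplace_map g x \o cinv c = (fun p => - 2 *: H p).
      by apply/funext => p /=; rewrite laplace_mapE.
    exact: (is_derive_scale (is_derive_cst (- 2 : R) q (ebase R a)) (dvec_derive a SH Uq)).
  by case: D => _ ->; rewrite scale0r add0r.
have := hom (cinv c q) (ebase R i) (ebase R j) cq.
rewrite !D dotZl dotZr /metric_at E ebase_form -(gram_gmat hx Mc i j Uq) => K.
transitivity (4^-1 * (- 2 * (- 2 * dot (dvec H i q) (dvec H j q)))); first by field.
by rewrite K; field.
Qed.

End parallel_homothetic.

(** * Hyperspheres *)

Section in_sphere.
Context {R : realType} {n m : nat} {M : smooth_manifold R n}.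
Variables (g : riemannian_metric M) (x : M -> 'rV[R]_m).
Variables (a : 'rV[R]_m) (r : R).
Hypotheses (hx : isometric_immersion g x) (n0 : (0 < n)%N) (r0 : 0 < r).
Hypothesis xr : forall p, enorm (x p - a) = r.

Lemma dot_sphere p : dot (x p - a) (x p - a) = r ^+ 2.
Proof. by rewrite -(xr p) /enorm sqr_sqrtr // dot_ge0. Qed.

Lemma sphere_position_derive c q j : atlas M c -> cimg c q ->
  is_derive q (ebase R j) (fun q => x (cinv c q) - a) (dvec (x \o cinv c) j q).
Proof.
move=> Mc cq.
have := is_derive_add (dvec_derive j (chart_smooth hx Mc) cq)
  (is_derive_cst (- a) q (ebase R j)).
by rewrite addr0.
Qed.

Lemma sphere_position_normal c q j : atlas M c -> cimg c q ->
  dot (x (cinv c q) - a) (dvec (x \o cinv c) j q) = 0.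
Proof.
move=> Mc cq; have D := sphere_position_derive j Mc cq.
have := derive_cst_on (open_cimg c) cq (fun q _ => dot_sphere (cinv c q)) (is_derive_dot D D).
rewrite dotC => E; apply: (@mulfI R 2); first by rewrite pnatr_eq0.
by rewrite mulr0 -[RHS]E; ring.
Qed.

(** Differentiate the orthogonality of x - a to the surface: in the direction x - a the second
    fundamental form is minus the metric. *)
Lemma sphere_position_hessian c q j k : atlas M c -> cimg c q ->
  dot (hessian_vector x c q j k) (x (cinv c q) - a) = - gmat g c q j k.
Proof.
move=> Mc cq; rewrite (gmat_dot hx j k Mc cq) /hessian_vector -!dvecE.
have D := is_derive_dot (sphere_position_derive j Mc cq)
  (dvec_derive j (dvec_smooth k (chart_smooth hx Mc)) cq).
have := derive_cst_on (open_cimg c) cq (fun p cp => sphere_position_normal k Mc cp) D.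
by rewrite addrC (dotC (_ - _)) => /eqP; rewrite addr_eq0 => /eqP.
Qed.

Lemma mean_curvature_in_sphereE p :
  mean_curvature_in_sphere g x a r p = mean_curvature g x p + (r ^+ 2)^-1 *: (x p - a).
Proof.
rewrite /mean_curvature_in_sphere /mean_curvature; set c := chart_at p.
have [Mc cp] : atlas M c /\ cdom c p := chart_atP p.
have cq := cimg_cmap cp; set q := cmap c p in cq *.
have cK : cinv c q = p by rewrite /q cmapK.
have nn : n%:R != 0 :> R by rewrite pnatr_eq0 -lt0n.
have rn : r != 0 by rewrite gt_eqF.
have S j k : second_fundamental_form_in_sphere g x a r c p j k =
    second_fundamental_form g x c p j k + (gmat g c q j k / r ^+ 2) *: (x p - a).
  rewrite /second_fundamental_form_in_sphere /second_fundamental_form.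
  rewrite !(normal_partE g x _ Mc cp) /sphere_tangent_part mulmxBl -scalemxAl -/q.
  have -> : (x p - a) *m nproj g x c q = x p - a.
    by apply: nproj_normal => b; rewrite -dvecE -cK sphere_position_normal.
  have -> : dot (ambient_deriv x c p j k) (x p - a) = - gmat g c q j k.
    by rewrite -(sphere_position_hessian j k Mc cq) cK.
  by rewrite mulNr scaleNr opprK.
have T : trace_form g c p (second_fundamental_form_in_sphere g x a r c p) =
    trace_form g c p (second_fundamental_form g x c p) + (n%:R / r ^+ 2) *: (x p - a).
  transitivity (\sum_j \sum_k (ginv g c q j k *: second_fundamental_form g x c p j k +
      (ginv g c q j k * gmat g c q k j / r ^+ 2) *: (x p - a))).
    apply: eq_bigr => j _; apply: eq_bigr => k _; rewrite S scalerDr scalerA.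
    have -> : gmat g c q j k = gmat g c q k j by rewrite -[in LHS](gmat_sym g Mc cq) mxE.
    by rewrite mulrA.
  (* The trace of the metric against its inverse is the dimension, which the factor 1/n in the mean
     curvature cancels. *)
  have -> : n%:R = \sum_j \sum_k ginv g c q j k * gmat g c q k j :> R.
    rewrite -(@mxtrace1 R n) -(mulVmx (gmat_unit g Mc cq)).
    by apply: eq_bigr => j _; rewrite mxE.
  rewrite mulr_suml scaler_suml -big_split /=; apply: eq_bigr => j _.
  by rewrite mulr_suml scaler_suml -big_split.
rewrite T scalerDr scalerA; congr (_ + _ *: _).
by rewrite mulrA mulVf // mul1r.
Qed.

End in_sphere.

(** The preimage of every set of values is open, so each level set is open with open complement. *)
Lemma locally_constant_connected (T : topologicalType) (S : Type) (f : T -> S) :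
  connected [set: T] -> (forall p, nbhs p [set p' | f p' = f p]) ->
  forall p p', f p' = f p.
Proof.
move=> cT fl p p'.
have op (A : set S) : open [set z | A (f z)].
  rewrite openE => z Az; apply: (@filterS _ _ (nbhs_filter z)) (fl z).
  by move=> t /= ->.
have E : [set z | f z = f p] = [set: T].
  apply: cT; first by exists p.
    by exists [set z | f z = f p]; rewrite ?setTI //; exact: (op [set s | s = f p]).
  exists [set z | f z = f p]; rewrite ?setTI // -[X in closed X]setCK.
  by apply: open_closedC; exact: (op [set s | s <> f p]).
by have : [set: T] p' by []; rewrite -E.
Qed.

(** * Local constancy of the curvature and of the centre *)

Section homothetic_umbilic.
Context {R : realType} {m : nat} {M : smooth_manifold R 2}.
Variables (g : riemannian_metric M) (x : M -> 'rV[R]_m) (k : R).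
Hypotheses (hx : isometric_immersion g x) (hH : parallel_normalized_mean_curvature g x).
Hypothesis k0 : 0 < k.
Hypothesis hom : forall c p (u v : 'rV[R]_2), atlas M c -> cdom c p ->
  dot (dmap (laplace_map g x) c p u) (dmap (laplace_map g x) c p v) =
  k ^+ 2 * metric_at g c p u v.

Lemma chart_umbilic c q j : atlas M c -> cimg c q ->
  dscal (normsq (mean_curvature g x \o cinv c)) j q = 0 /\
  dvec (mean_curvature g x \o cinv c) j q =
    - normsq (mean_curvature g x \o cinv c) q *: dvec (x \o cinv c) j q.
Proof.
move=> Mc cq; have homc p u v := @hom c p u v Mc.
have Hn p : cimg c p -> (mean_curvature g x \o cinv c) p != 0.
  by move=> _; exact: hH.1.
split.
- exact: (gradient_eq0 (open_cimg c) (chart_smooth hx Mc) (mean_curvature_smooth hx Mc) k0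
    (gdet_gt0 hx Mc) Hn (mean_curvature_dvec hx Mc) (mean_curvature_trace hx Mc)
    (parallel_chart hx hH Mc) (homothetic_chart hx Mc homc)).
- exact: (umbilic (open_cimg c) (chart_smooth hx Mc) (mean_curvature_smooth hx Mc) k0
    (gdet_gt0 hx Mc) Hn (mean_curvature_dvec hx Mc) (mean_curvature_trace hx Mc)
    (parallel_chart hx hH Mc) (homothetic_chart hx Mc homc)).
Qed.

(** The value u and the centre x + H/u are paired, so that a single connectedness argument makes
    both constant. *)
Definition curvature_center p : R * 'rV[R]_m :=
  (dot (mean_curvature g x p) (mean_curvature g x p),
   x p + (dot (mean_curvature g x p) (mean_curvature g x p))^-1 *: mean_curvature g x p).

Lemma curvature_center_locally_constant p :
  nbhs p [set p' | curvature_center p' = curvature_center p].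
Proof.
have [Mc cp] := chart_atP p; set c := chart_at p in Mc cp.
pose y := x \o cinv c; pose H := mean_curvature g x \o cinv c.
have cq := cimg_cmap cp; set q := cmap c p in cq.
have [r r0 rU] := open_rV_ball (open_cimg c) cq.
have oB : open (ball q r) by exact: ball_open.
have SH := mean_curvature_smooth hx Mc.
have Sy := chart_smooth hx Mc.
have Su : smooth_on (cimg c) (normsq H) := normsq_smooth (open_cimg c) SH.
have uc s : ball q r s -> normsq H s = normsq H q.
  move=> Bs; apply: (gradient_eq0_ball (open_cimg c) Su rU) Bs => j t Ut.
  by have [+ _] := chart_umbilic j Mc Ut; rewrite dscalE.
have un : normsq H q != 0 by rewrite gt_eqF //; exact: dot_gt0 (hH.1 _).
(* The scalar is frozen at its value at q, so that db = dy + dH/u(q), and this vanishes by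
   [chart_umbilic] and [uc]. *)
pose b s : 'rV[R]_m := y s + (normsq H q)^-1 *: H s.
have Sb : smooth_on (ball q r) b.
  apply: smoothD => //; first exact: smooth_sub rU Sy.
  by apply: smoothZ => //; [exact: smooth_cst | exact: smooth_sub rU SH].
have bc s : ball q r s -> b s = b q.
  move=> Bs; apply/rowP => i.
  apply: (gradient_eq0_ball oB (smooth_coord i oB Sb) (@subset_refl _ _)) Bs => j t Bt.
  have Ut := rU _ Bt.
  have D := is_derive_add (dvec_derive j Sy Ut)
    (is_derive_scale (is_derive_cst (normsq H q)^-1 t (ebase R j)) (dvec_derive j SH Ut)).
  rewrite (pderiv_val (is_derive_coord i D)) (chart_umbilic j Mc Ut).2 -/H uc //.
  by rewrite scale0r add0r scalerA mulrN mulVf // scaleN1r subrr mxE.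
have nB : nbhs p (cdom c `&` (cmap c @^-1` ball q r)).
  apply: (@filterI _ _ (nbhs_filter p)).
    by apply: open_nbhs_nbhs; split=> //; exact: cdom_open.
  by apply: (cmap_cont cp); exact: nbhsx_ballx.
apply: (@filterS _ _ (nbhs_filter p)) nB => p' [cp' Bp'] /=.
have E1 := uc _ Bp'; have E2 := bc _ Bp'.
have K : cinv c (cmap c p') = p' := cmapK cp'; have K0 : cinv c q = p := cmapK cp.
pose F z := dot (mean_curvature g x z) (mean_curvature g x z).
have nq : normsq H q = F p := congr1 F K0.
have np : F p' = normsq H q := etrans (esym (congr1 F K)) E1.
pose B s z := x z + s^-1 *: mean_curvature g x z.
have E3 : B (normsq H q) p' = B (normsq H q) p :=
  etrans (esym (congr1 (B _) K)) (etrans E2 (congr1 (B _) K0)).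
have E4 : B (F p') p' = B (F p) p :=
  etrans (congr1 (B^~ p') np) (etrans E3 (congr1 (B^~ p) nq)).
exact: (congr2 pair (etrans np nq) E4).
Qed.

End homothetic_umbilic.

Lemma sub_center (R : realType) m (v a h : 'rV[R]_m) (s t : R) :
  v + s^-1 *: h = a -> s = t -> v - a = - t^-1 *: h.
Proof. by move=> <- <-; rewrite opprD addrA subrr add0r scaleNr. Qed.

Section main.
Context {R : realType} {m : nat} {M : smooth_manifold R 2}.
Variables (g : riemannian_metric M) (x : M -> 'rV[R]_m).
Hypotheses (hM : connected [set: M]) (hx : isometric_immersion g x).
Hypothesis hH : parallel_normalized_mean_curvature g x.

Lemma homothetic_minimal : homothetic g (laplace_map g x) -> minimal_in_hypersphere g x.
Proof.
move=> [k k0 hom].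
have [[p0 _]|noM] := pselect (exists p : M, True); last first.
  (* On the empty surface any hypersphere will do; the centre 0 and radius 1 are arbitrary. *)
  by exists 0, 1; split=> // p; case: noM; exists p.
have lc := locally_constant_connected hM (curvature_center_locally_constant hx hH k0 hom) p0.
have [u [a [u0 uE xE]]] : exists (u : R) (a : 'rV[R]_m), [/\ 0 < u,
    forall p, dot (mean_curvature g x p) (mean_curvature g x p) = u &
    forall p, x p - a = - u^-1 *: mean_curvature g x p].
  exists (curvature_center g x p0).1, (curvature_center g x p0).2.
  split=> [|p|p]; first exact: dot_gt0 (hH.1 p0).
    exact: (congr1 (@fst R 'rV[R]_m) (lc p)).
  have E : x p + (curvature_center g x p).1^-1 *: mean_curvature g x p =
    (curvature_center g x p0).2 := congr1 (@snd R 'rV[R]_m) (lc p).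
  have Ep := congr1 (@fst R 'rV[R]_m) (lc p).
  exact: sub_center E Ep.
have un : u != 0 by rewrite gt_eqF.
(* As x - a = -H/u and |H|^2 = u, the squared radius is 1/u. *)
have xr p : enorm (x p - a) = Num.sqrt u^-1.
  by rewrite /enorm xE dotZl dotZr uE; congr Num.sqrt; field.
have r0 : 0 < Num.sqrt u^-1 by rewrite sqrtr_gt0 invr_gt0.
exists a, (Num.sqrt u^-1); split=> // p.
rewrite (mean_curvature_in_sphereE hx _ r0 xr) // xE sqr_sqrtr ?invr_ge0 ?ltW //.
by rewrite invrK scalerA mulrN mulfV // scaleN1r subrr.
Qed.

Lemma minimal_homothetic : minimal_in_hypersphere g x -> homothetic g (laplace_map g x).
Proof.
move=> [a [r [r0 xr Hs]]].
have HE p : mean_curvature g x p = - (r ^+ 2)^-1 *: (x p - a).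
  have := Hs p; rewrite (mean_curvature_in_sphereE hx _ r0 xr) // => /eqP.
  by rewrite addr_eq0 scaleNr => /eqP.
exists (2 / r ^+ 2); first by rewrite divr_gt0 // exprn_gt0.
move=> c p u v Mc cp.
have D w : dmap (laplace_map g x) c p w = (2 / r ^+ 2) *: dmap x c p w.
  have Dx := smooth_derive_dir w (open_cimg c) (chart_smooth hx Mc) (cimg_cmap cp).
  have LE : laplace_map g x \o cinv c = (fun q => (2 / r ^+ 2) *: ((x \o cinv c) q + - a)).
    apply/funext => q /=; rewrite (laplace_mapE hx) HE scalerA; congr (_ *: _).
    by rewrite mulrNN.
  have := is_derive_scale (is_derive_cst (2 / r ^+ 2) (cmap c p) w)
    (is_derive_add Dx (is_derive_cst (- a) (cmap c p) w)).
  rewrite -LE scale0r add0r addr0 => -[_ E].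
  by rewrite /dmap E; case: Dx => _ ->.
have [_ iso] := hx.
by rewrite !D dotZl dotZr iso // expr2 mulrA.
Qed.

End main.

Theorem theorem3p1 (R : realType) (m : nat) (M : smooth_manifold R 2)
    (g : riemannian_metric M) (x : M -> 'rV[R]_m)
    (hM : connected [set: M])
    (hx : isometric_immersion g x)
    (hH : parallel_normalized_mean_curvature g x) :
  homothetic g (laplace_map g x) <-> minimal_in_hypersphere g x.
Proof.
split; first exact: homothetic_minimal hM hx hH.
exact: minimal_homothetic hx.
Qed.
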